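(* Let $\ell,d\geq 1$, $p>2$, $T>0$, let $\mathbf{X}$ be a Hölder branched $p$-rough path over $\mathbb{R}^\ell$ on $[0,T]$, and let $V_1,\dots,V_\ell$ be vector fields on $\mathbb{R}^d$ of class $C^\gamma$ for some $\gamma>p$. An $\mathbb{R}^d$-valued path $(z_t)_{0\leq t\leq T}$ is a solution to the rough differential equation $dz_t=\mathrm{F}(z_t)\,d\mathbf{X}_t$, $\mathrm{F}=(V_1,\dots,V_\ell)$, driven by the branched rough path $\mathbf{X}$ in the sense of Davie if and only if it is a solution of that equation in the sense of Bailleul.
   Context: Trees: $\mathcal{T}$ is the set of rooted trees with vertices labelled in $\{1,\dots,\ell\}$, including the empty tree $\mathbf{1}$; for trees $\tau_1,\dots,\tau_k$ and a label $a$, $[\tau_1\cdots\tau_k]_a$ is the tree obtained by grafting $\tau_1,\dots,\tau_k$ onto a new root labelled $a$ ($\bullet_a=[\,]_a$). $|\tau|$ is the number of vertices. Symmetry factor: $\sigma([\tau_1^{n_1}\cdots\tau_k^{n_k}]_a)=n_1!\cdots n_k!\,\sigma(\tau_1)^{n_1}\cdots\sigma(\tau_k)^{n_k}$ for distinct $\tau_i$ with multiplicities $n_i$ (so $\sigma(\bullet_a)=1$); for a forest $\tau_1\cdots\tau_n$, $\sigma(\tau_1\cdots\tau_n):=\sigma([\tau_1\cdots\tau_n]_a)$ (independent of $a$). $\mathcal{F}$ is the commutative polynomial algebra generated by the nonempty trees (unit $\mathbf{1}$); its monomials $\varphi=\tau_1\cdots\tau_n$ are forests, $|\varphi|=\sum|\tau_i|$,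 and they form a basis $\mathcal{B}$ with dual basis $(\theta^* )$ of the dual $\mathcal{F}^*$. Coproduct: for a tree $\tau$, $\Delta\tau=\sum_{s}(\tau\setminus s)\otimes s$, the sum over subtrees $s$ of $\tau$ containing the root of $\tau$ (including the empty tree and $\tau$), where $\tau\setminus s$ is the forest of trees obtained by removing $s$ and its adjacent edges; $\Delta$ is extended multiplicatively and linearly. For $\mathbf{Y},\mathbf{Z}\in\mathcal{F}^*$, $\langle\mathbf{Y}\star\mathbf{Z},\theta\rangle=(\mathbf{Y}\otimes\mathbf{Z})(\Delta\theta)$. $\exp_\star(\mathbf{a})=\sum_{n\geq0}\mathbf{a}^{\star n}/n!$ ($\mathbf{a}^{\star0}=\mathbf{1}^*$), $\log_\star(\mathbf{b})=\sum_{n\geq1}(\mathbf{1}^*-\mathbf{b})^{\star n}/n$ (with the sign convention of the paper, i.e. the inverse of $\exp_\star$ on elements with $\langle\mathbf{b},\mathbf{1}\rangle=1$). For an integer $N$, $\pi_{\leq N}$ is the projection of $\mathcal{F}^*$ killing the dual forests $\theta^*$ with $|\theta|>N$, and $\mathcal{G}^N_\ell=\pi_{\leq N}\exp_\star(\langle\mathcal{T}^*\rangle)$, a group under $\pi_{\leq N}\circ\star$ (still denoted $\star$), where $\langle\mathcal{T}^*\rangle$ is the span of the dual trees. A Hölder branched $p$-rough path on $[0,T]$ is a path $\mathbf{X}:[0,T]\to\mathcal{G}^{[p]}_\ell$ such that, with $\mathbf{X}_{ts}:=\mathbf{X}_s^{-1}\star\mathbf{X}_t$ and $X^\varphi_{ts}:=\langle\mathbf{X}_{ts},\varphi\rangle$,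 $\sup_{s<t}|X^\varphi_{ts}|/|t-s|^{|\varphi|/p}<\infty$ for every forest $\varphi$ with $|\varphi|\leq[p]$. Differential operators: $V(\bullet_a^* )=V_a$ and recursively $V(([\tau_1\cdots\tau_n]_a)^* )=\frac{1}{\sigma([\tau_1\cdots\tau_n]_a)}(D^nV_a)(V(\tau_1^* ),\dots,V(\tau_n^* ))$ (vector fields), and for a nonempty forest, $V(\tau_1^*\cdots\tau_n^* )f=\frac{1}{\sigma(\tau_1\cdots\tau_n)}(D^nf)(V(\tau_1^* ),\dots,V(\tau_n^* ))$. A path $z$ is a solution in the sense of Davie if for some $a>1$ and all $0\leq s\leq t\leq T$, $z_t=z_s+\sum_{\varphi\in\mathcal{B},\,1\leq|\varphi|\leq[p]}X^\varphi_{ts}\,(V(\varphi^* )\mathrm{Id})(z_s)+O(|t-s|^a)$. It is a solution in the sense of Bailleul if for some $a>1$, every real-valued $C^\gamma$ function $f$ on $\mathbb{R}^d$ and all $0\leq s\leq t\leq T$, $f(z_t)=f(z_s)+\sum_{\varphi\in\mathcal{B},\,1\leq|\varphi|\leq[p]}X^\varphi_{ts}\,(V(\varphi^* )f)(z_s)+O_f(|t-s|^a)$, where $O_f$ may depend on $f$. *)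

(* Defs.v *)
From HB Require Import structures.
From mathcomp Require Import all_boot all_order all_algebra.
From mathcomp Require Import boolp classical_sets reals topology normedtype derive exp.
From Stdlib Require Import ClassicalEpsilon.
Set Implicit Arguments. Unset Strict Implicit. Unset Printing Implicit Defensive.
Import Order.TTheory GRing.Theory Num.Theory.
Import numFieldNormedType.Exports.
Local Open Scope ring_scope.

(* Labelled rooted trees.  A raw tree is [GenTree.Node a children]     *)
(* (label a : nat, 0-based, so label a stands for a+1 in {1..l});     *)
(* the type void ensures there are no leaves.  Children are an ordered *)
(* list; unordered trees are handled through the canonical form       *)
(* [canon], which recursively sorts children (by their pickle code).  *)
(* A raw forest is a seq of trees; [cf] gives its canonical form, so  *)
(* forests (= monomials of F, the basis B) are the canonical seqs.    *)
(* The empty forest [::] is the unit 1.                                *)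
Definition rtree := GenTree.tree void.

Definition pick_le (x y : rtree) := (pickle x <= pickle y)%N.

Fixpoint canon (t : rtree) : rtree :=
  match t with
  | GenTree.Leaf x => GenTree.Leaf x
  | GenTree.Node a ch => GenTree.Node a (sort pick_le (map canon ch))
  end.

Definition cf (f : seq rtree) : seq rtree := sort pick_le (map canon f).

Fixpoint wft (l : nat) (t : rtree) : bool :=
  match t with
  | GenTree.Leaf _ => false
  | GenTree.Node a ch => (a < l)%N && all (wft l) ch
  end.

Fixpoint tsize (t : rtree) : nat :=
  match t with
  | GenTree.Leaf _ => 0
  | GenTree.Node _ ch => (sumn (map tsize ch)).+1
  end.
Definition fsize (f : seq rtree) : nat := sumn (map tsize f).

(* symmetry factors: sigma([t1^n1 ... tk^nk]_a) = prod n_i! sigma(t_i)^n_i,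
   sigma of a forest = sigma of the tree obtained by grafting it on a root *)
Definition mult_fact (f : seq rtree) : nat :=
  let cs := map canon f in foldr muln 1%N [seq (count_mem u cs)`! | u <- undup cs].

Fixpoint sigma (t : rtree) : nat :=
  match t with
  | GenTree.Leaf _ => 1%N
  | GenTree.Node _ ch => (mult_fact ch * foldr muln 1%N (map sigma ch))%N
  end.
Definition sigmaf (f : seq rtree) : nat := (mult_fact f * foldr muln 1%N (map sigma f))%N.

(* Coproduct.  [ncuts t] lists, with multiplicity, the pairs           *)
(* (t \ s, s) for the NONEMPTY subtrees s of t containing the root.    *)
Definition prod_opts (ls : seq (seq (seq rtree * option rtree))) :
    seq (seq rtree * seq rtree) :=
  foldr (fun opts acc =>
           [seq (o.1 ++ r.1, if o.2 is Some s then s :: r.2 else r.2)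
           | o <- opts, r <- acc]) [:: ([::], [::])] ls.

Fixpoint ncuts (t : rtree) : seq (seq rtree * rtree) :=
  match t with
  | GenTree.Leaf _ => [::]
  | GenTree.Node a ch =>
      [seq (r.1, GenTree.Node a r.2)
      | r <- prod_opts
               (map (fun c => ([:: c], None) ::
                               map (fun q => (q.1, Some q.2)) (ncuts c)) ch)]
  end.

(* Delta t = t (x) 1 + sum_{s nonempty rooted subtree} (t \ s) (x) s *)
Definition delta (t : rtree) : seq (seq rtree * seq rtree) :=
  ([:: t], [::]) :: [seq (q.1, [:: q.2]) | q <- ncuts t].

Definition coprod (f : seq rtree) : seq (seq rtree * seq rtree) :=
  foldr (fun t acc => [seq (x.1 ++ y.1, x.2 ++ y.2) | x <- delta t, y <- acc])
        [:: ([::], [::])] f.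

(* The dual F^*: an element Y is given by its coordinates on the basis *)
(* of forests; we represent it by a function on raw forests and only   *)
(* ever read it on canonical forms: <Y, phi> := Y (cf phi).            *)
Section Dual.
Variable R : realType.
Definition dual := seq rtree -> R.

Definition pair (Y : dual) (phi : seq rtree) : R := Y (cf phi).

Definition deq (Y Z : dual) : Prop := forall phi, pair Y phi = pair Z phi.

Definition dunit : dual := fun phi => (phi == [::])%:R.

Definition conv (Y Z : dual) : dual :=
  fun theta => \sum_(xy <- coprod theta) pair Y xy.1 * pair Z xy.2.

Fixpoint cpow (a : dual) (n : nat) : dual :=
  if n is n'.+1 then conv a (cpow a n') else dunit.

(* exp_*(a) for a with <a,1> = 0 (e.g. a in the span of dual trees):
   a^{*n} vanishes on forests of size < n, so the series is finite. *)
Definition cexp (a : dual) : dual :=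
  fun theta => \sum_(n < (fsize theta).+1) pair (cpow a n) theta / (n`!)%:R.

Definition in_span_trees (l : nat) (a : dual) : Prop :=
  (forall phi, ~~ ((size (cf phi) == 1%N) && all (wft l) phi) -> pair a phi = 0)
  /\ exists M : nat, forall phi, (M < fsize phi)%N -> pair a phi = 0.

Definition proj (N : nat) (Y : dual) : dual :=
  fun phi => if (fsize phi <= N)%N then Y phi else 0.

Definition inG (l N : nat) (g : dual) : Prop :=
  exists a, in_span_trees l a /\ deq g (proj N (cexp a)).

Definition gmul (N : nat) (Y Z : dual) : dual := proj N (conv Y Z).

Definition ginv (N : nat) (g : dual) : dual :=
  epsilon (inhabits (fun _ => 0 : R))
    (fun h => deq (proj N h) h /\ deq (gmul N h g) (proj N dunit)).

Definition ip (p : R) : nat := Num.truncn p.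

Definition incr (p : R) (X : R -> dual) (s t : R) : dual :=
  gmul (ip p) (ginv (ip p) (X s)) (X t).

Definition branched_rough_path (l : nat) (p T : R) (X : R -> dual) : Prop :=
  (forall t, 0 <= t <= T -> inG l (ip p) (X t)) /\
  (forall phi : seq rtree, all (wft l) phi -> (fsize phi <= ip p)%N ->
     exists C : R, forall s t, 0 <= s -> s < t -> t <= T ->
       `|pair (incr p X s t) phi| <= C * (t - s) `^ ((fsize phi)%:R / p)).

Fixpoint raw_forests (l fuel n : nat) {struct fuel} : seq (seq rtree) :=
  if n is 0 then [:: [::]] else
  if fuel is fuel'.+1 then
    flatten [seq flatten [seq [seq GenTree.Node a f :: g
                               | f <- raw_forests l fuel' k.-1,
                                 g <- raw_forests l fuel' (n - k)]
                         | a <- iota 0 l]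
            | k <- iota 1 n]
  else [::].

Definition basis_upto (l N : nat) : seq (seq rtree) :=
  undup [seq cf phi | n <- iota 1 N, phi <- raw_forests l n n].

Variable d : nat.
Notation E := 'rV[R]_d.

(* iterated directional derivative: Dn f [:: v1; ..; vn] x = D^n f(x)(v1,..,vn) *)
Fixpoint Dn (W : normedModType R) (f : E -> W) (vs : seq E) : E -> W :=
  match vs with
  | [::] => f
  | v :: vs' => fun x => 'D_v (Dn f vs') x
  end.

Definition Ck (W : normedModType R) (f : E -> W) (k : nat) : Prop :=
  forall vs : seq E, (size vs <= k)%N ->
    continuous (Dn f vs) /\
    ((size vs < k)%N -> forall x v, derivable (Dn f vs) x v).

Definition Cgamma (W : normedModType R) (gamma : R) (f : E -> W) : Prop :=
  exists k : nat, k%:R < gamma <= k.+1%:R /\ Ck f k /\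
    forall M : R, exists C : R, forall (vs : seq E) (x y : E),
      size vs = k -> all (fun v => `|v| <= 1) vs -> `|x| <= M -> `|y| <= M ->
      `|Dn f vs x - Dn f vs y| <= C * `|x - y| `^ (gamma - k%:R).

Variable l : nat.
Variable V : 'I_l -> E -> E.

Definition Vlab (a : nat) : E -> E :=
  match @insub _ (fun i => i < l)%N _ a with Some i => V i | None => fun _ => 0 end.

Fixpoint Vt (t : rtree) : E -> E :=
  match t with
  | GenTree.Leaf _ => fun _ => 0
  | GenTree.Node a ch => fun x =>
      ((sigma t)%:R)^-1 *: Dn (Vlab a) (map (fun c => Vt c x) ch) x
  end.

Definition Vf (W : normedModType R) (f : E -> W) (phi : seq rtree) : E -> W :=
  fun x => ((sigmaf phi)%:R)^-1 *: Dn f (map (fun c => Vt c x) phi) x.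

Definition davie_sol (p T : R) (X : R -> dual) (z : R -> E) : Prop :=
  exists a : R, 1 < a /\ exists C : R, forall s t, 0 <= s -> s <= t -> t <= T ->
    `|z t - z s - \sum_(phi <- basis_upto l (ip p))
        pair (incr p X s t) phi *: Vf (@id E) phi (z s)| <= C * (t - s) `^ a.

Definition bailleul_sol (p T gamma : R) (X : R -> dual) (z : R -> E) : Prop :=
  exists a : R, 1 < a /\ forall f : E -> R^o, Cgamma gamma f ->
    exists C : R, forall s t, 0 <= s -> s <= t -> t <= T ->
    `|f (z t) - f (z s) - \sum_(phi <- basis_upto l (ip p))
        pair (incr p X s t) phi * Vf f phi (z s)| <= C * (t - s) `^ a.

End Dual.

(* Main.v *)
From HB Require Import structures.
From mathcomp Require Import all_boot all_order all_algebra.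
From mathcomp Require Import boolp classical_sets reals topology normedtype derive exp.
From mathcomp Require Import zify ring lra.
From Stdlib Require Import ClassicalEpsilon.
Require Import Defs.
Set Implicit Arguments. Unset Strict Implicit. Unset Printing Implicit Defensive.
Import Order.TTheory GRing.Theory Num.Theory.
Import numFieldNormedType.Exports.
Local Open Scope ring_scope.

(* Testing Bailleul's expansion on the coordinate functions gives Davie's.
   Conversely, the operator attached to a forest with at least two trees kills Id, so
   Davie's expansion reads z_t = z_s + y + O(|t-s|^a), where y is a sum over trees of
   X^tau W(tau)(z_s).  Taylor's formula of order [p] for f at z_s in the direction y,
   expanded by multilinearity of the derivatives, is a sum over words of trees.  The
   words with more than [p] vertices are O(|t-s|^(([p]+1)/p)).  The others are grouped
   by the forest they spell: a forest with multiplicities n_i is spelled by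
   n!/(n_1!...n_k!) words, the derivatives are symmetric, and the product of the X^tau
   is X^phi because the increments X_ts are multiplicative on forests. *)

(** [Ck] only provides continuous iterated directional derivatives, so linearity in each direction
    and symmetry are proved by the mean value theorem along lines. On the algebraic side, [ginv] is
    known only through the truncated equation saying that it is a left inverse, and its
    multiplicativity has to be deduced from that equation. The constants in the remainders come from
    bounds on balls, which requires [z] to be bounded; this is itself read off Davie's expansion
    started at time 0. The exponent obtained is min(a, min(gamma, [p]+1)/p): it exceeds 1 because
    gamma and [p]+1 both exceed p, and it is the same for all test functions, as Bailleul's
    definition demands. *)

(** * Canonical forms of trees and forests *)

Lemma rtree_nested_ind (P : rtree -> Prop) :
  (forall a ch, {in ch, forall c, P c} -> P (GenTree.Node a ch)) ->
  forall t, P t.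
Proof.
move=> H; elim=> [[]|a ch IH]; apply: H.
by elim: ch IH => //= c ch IH [Pc /IH Pch] u; rewrite inE => /predU1P[->|/Pch].
Qed.

Lemma pick_le_total : total pick_le.
Proof. by move=> x y; apply: leq_total. Qed.

Lemma pick_le_trans : transitive pick_le.
Proof. by move=> y x z; apply: leq_trans. Qed.

Lemma pick_le_anti : antisymmetric pick_le.
Proof. by move=> x y xy; apply/(pcan_inj (@pickleK _))/eqP; rewrite eqn_leq. Qed.

(** Injectivity of [pickle] makes [pick_le] antisymmetric, so a sorted list is determined by its
    multiset; identities between canonical forms become permutation statements. *)
Lemma sort_pick_leP (s1 s2 : seq rtree) :
  reflect (sort pick_le s1 = sort pick_le s2) (perm_eq s1 s2).
Proof. exact: perm_sortP pick_le_total pick_le_trans pick_le_anti _ _. Qed.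

Lemma canonK t : canon (canon t) = canon t.
Proof.
elim/rtree_nested_ind: t => a ch IH /=; congr GenTree.Node.
have -> : map canon (sort pick_le (map canon ch)) = sort pick_le (map canon ch).
  rewrite -[RHS]map_id; apply/eq_in_map => u.
  by rewrite mem_sort => /mapP[c cch ->]; exact: IH.
exact: (sorted_sort pick_le_trans (sort_sorted pick_le_total _)).
Qed.

Lemma map_canon_cf f : map canon (cf f) = cf f.
Proof.
rewrite -[RHS]map_id; apply/eq_in_map => u.
by rewrite mem_sort => /mapP[c _ ->]; exact: canonK.
Qed.

Lemma cfK f : cf (cf f) = cf f.
Proof.
rewrite {1}/cf map_canon_cf.
exact: (sorted_sort pick_le_trans (sort_sorted pick_le_total _)).
Qed.

Lemma perm_cf f : perm_eq (cf f) (map canon f).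
Proof. by rewrite perm_sort. Qed.

Lemma eq_cf_perm f g : perm_eq f g -> cf f = cf g.
Proof. by move=> fg; apply/sort_pick_leP; exact: perm_map. Qed.

Lemma cf_cat_cf f g : cf (cf f ++ cf g) = cf (f ++ g).
Proof.
apply/sort_pick_leP; rewrite !map_cat !map_canon_cf.
by apply: perm_cat; exact: perm_cf.
Qed.

Lemma tsize_canon t : tsize (canon t) = tsize t.
Proof.
elim/rtree_nested_ind: t => a ch IH /=; congr S.
rewrite (perm_sumn (perm_map tsize (permEl (perm_sort pick_le _)))).
by rewrite -map_comp; congr sumn; apply/eq_in_map.
Qed.

Lemma fsize_cf f : fsize (cf f) = fsize f.
Proof.
rewrite /fsize (perm_sumn (perm_map tsize (perm_cf f))) -map_comp.
by congr sumn; apply: eq_map => t; exact: tsize_canon.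
Qed.

Lemma fsize_cat f g : fsize (f ++ g) = (fsize f + fsize g)%N.
Proof. by rewrite /fsize map_cat sumn_cat. Qed.

Lemma fsize_cons t f : fsize (t :: f) = (tsize t + fsize f)%N.
Proof. by []. Qed.

Lemma tsize_gt0 t : (0 < tsize t)%N.
Proof. by case: t => [[]|]. Qed.

Lemma size_le_fsize f : (size f <= fsize f)%N.
Proof.
by elim: f => //= t f IH; rewrite fsize_cons -add1n leq_add ?tsize_gt0.
Qed.

Lemma fsize_eq0 f : (fsize f == 0%N) = (f == [::]).
Proof. by case: f => // t f; rewrite fsize_cons addn_eq0 -leqn0 leqNgt tsize_gt0. Qed.

Lemma wft_canon l t : wft l (canon t) = wft l t.
Proof.
elim/rtree_nested_ind: t => a ch IH /=; congr (_ && _).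
by rewrite all_sort all_map; apply: eq_in_all.
Qed.

Lemma all_wft_cf l f : all (wft l) (cf f) = all (wft l) f.
Proof. by rewrite all_sort all_map; apply: eq_all => t; exact: wft_canon. Qed.

Lemma cf1 t : cf [:: t] = [:: canon t]. Proof. by []. Qed.

Lemma size_cf f : size (cf f) = size f.
Proof. by rewrite size_sort size_map. Qed.

Lemma cf_eq_nil f : (cf f == [::]) = (f == [::]).
Proof. by rewrite -!size_eq0 size_cf. Qed.

(** * Combinatorics of the coproduct *)

(** For each child, being cut off whole or keeping a rooted subtree are exactly the terms of
    [delta]. This is the cocycle property of grafting, and it lets facts on forests and on trees be
    derived from each other. *)
Lemma ncuts_Node a ch :
  ncuts (GenTree.Node a ch) = [seq (r.1, GenTree.Node a r.2) | r <- coprod ch].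
Proof.
rewrite /=; congr map; elim: ch => //= c ch IH; rewrite {}IH.
by rewrite -[ncuts c in RHS]map_id -!map_comp /=; congr (_ ++ _);
   rewrite /allpairs_dep !map_id -!map_comp.
Qed.

Section CoproductSums.
Variable R : realType.
Implicit Types (f g : seq rtree) (Y Z h : dual R).

Lemma big_coprod_cons (G : seq rtree * seq rtree -> R) t f :
  \sum_(x <- coprod (t :: f)) G x =
  \sum_(x <- delta t) \sum_(y <- coprod f) G (x.1 ++ y.1, x.2 ++ y.2).
Proof.
rewrite -[coprod (t :: f)]/[seq (x.1 ++ y.1, x.2 ++ y.2) | x <- delta t, y <- coprod f].
by rewrite big_allpairs_dep.
Qed.

Lemma big_coprod_cat (G : seq rtree * seq rtree -> R) f g :
  \sum_(x <- coprod (f ++ g)) G x =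
  \sum_(x <- coprod f) \sum_(y <- coprod g) G (x.1 ++ y.1, x.2 ++ y.2).
Proof.
elim: f G => [|t f IH] G; first by rewrite big_seq1; apply: eq_bigr => -[].
rewrite cat_cons !big_coprod_cons; apply: eq_bigr => x _; rewrite IH.
by apply: eq_bigr => y _; apply: eq_bigr => z _; rewrite /= !catA.
Qed.

(** [coprod] lists ordered pairs of ordered forests, so reordering the argument is harmless only
    after summing an order-blind function. [catCA_perm_subst] reduces a permutation to swaps of
    adjacent blocks. *)
Lemma perm_big_coprod (G : seq rtree * seq rtree -> R) :
  (forall f1 f2 g1 g2, perm_eq f1 f2 -> perm_eq g1 g2 -> G (f1, g1) = G (f2, g2)) ->
  forall f g, perm_eq f g -> \sum_(x <- coprod f) G x = \sum_(x <- coprod g) G x.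
Proof.
move=> Gperm; apply: catCA_perm_subst => f1 f2 f3.
rewrite big_coprod_cat [RHS]big_coprod_cat.
under eq_bigr do rewrite big_coprod_cat.
under [RHS]eq_bigr do rewrite big_coprod_cat.
rewrite exchange_big; apply: eq_bigr => x _; apply: eq_bigr => y _.
by apply: eq_bigr => z _; apply: Gperm => /=; rewrite perm_catCA.
Qed.

Lemma big_ncuts_Node (G : seq rtree * rtree -> R) a ch :
  \sum_(q <- ncuts (GenTree.Node a ch)) G q =
  \sum_(r <- coprod ch) G (r.1, GenTree.Node a r.2).
Proof. by rewrite ncuts_Node big_map. Qed.

Lemma big_delta (G : seq rtree * seq rtree -> R) t :
  \sum_(x <- delta t) G x =
  G ([:: t], [::]) + \sum_(q <- ncuts t) G (q.1, [:: q.2]).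
Proof. by rewrite big_cons big_map. Qed.

Lemma coprod_counitr (F : seq rtree -> R) f :
  \sum_(x <- coprod f) (x.2 == [::])%:R * F x.1 = F f.
Proof.
elim: f F => [|t f IH] F; first by rewrite big_seq1 mul1r.
rewrite big_coprod_cons big_delta (IH (fun g => F (t :: g))) big1 ?addr0 // => q _.
by rewrite big1 // => y _; rewrite mul0r.
Qed.

Lemma ncuts_counitl (F : rtree -> R) t :
  \sum_(q <- ncuts t) (q.1 == [::])%:R * F q.2 = F t.
Proof.
elim/rtree_nested_ind: t F => a ch IH F; rewrite big_ncuts_Node /=.
suff H (G : seq rtree -> R) : \sum_(r <- coprod ch) (r.1 == [::])%:R * G r.2 = G ch.
  exact: (H (fun g => F (GenTree.Node a g))).
elim: ch IH G => [|c ch IHch] IH G.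
  by rewrite big_seq1 mul1r.
rewrite big_coprod_cons big_delta big1 ?add0r => [|y _]; last by rewrite mul0r.
rewrite -(IH c (mem_head _ _) (fun u => G (u :: ch))); apply: eq_bigr => q _.
rewrite -(IHch _ (fun g => G (q.2 :: g))) => [|u uch]; last first.
  by apply: IH; rewrite inE uch orbT.
rewrite mulr_sumr; apply: eq_bigr => y _; rewrite mulrA -natrM mulnb /=.
by congr ((_ : bool)%:R * _); case: (q.1).
Qed.

Lemma coprod_counitl (F : seq rtree -> R) f :
  \sum_(x <- coprod f) (x.1 == [::])%:R * F x.2 = F f.
Proof.
(* Graft [f] on a root with a dummy label and let [G] strip the root again. *)
pose G t := if t is GenTree.Node _ ch then F ch else 0.
by rewrite -[RHS](ncuts_counitl G (GenTree.Node 0 f)) big_ncuts_Node.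
Qed.

Lemma fsize_coprod f x : x \in coprod f -> (fsize x.1 + fsize x.2)%N = fsize f.
Proof.
(* The forest case is the tree case for [f] grafted on an extra root. *)
suff H t q : q \in ncuts t -> (fsize q.1 + tsize q.2)%N = tsize t.
  move=> xf; have := H (GenTree.Node 0 f) (x.1, GenTree.Node 0 x.2).
  rewrite ncuts_Node => /(_ (map_f _ xf)) /=.
  by rewrite -/(fsize x.2) -/(fsize f) addnS => -[].
elim/rtree_nested_ind: t q {x} => a ch IH q; rewrite ncuts_Node => /mapP[r rch ->].
rewrite /= -/(fsize r.2) -/(fsize ch) addnS; congr S.
elim: ch r rch IH => [|c ch IHch] r; first by rewrite inE => /eqP->.
case/allpairsP => -[x y] [/= xc ych ->] IH /=; rewrite !fsize_cat fsize_cons.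
have ychE : (fsize y.1 + fsize y.2)%N = fsize ch.
  by apply: IHch ych _ => u uch; apply: IH; rewrite inE uch orbT.
suff <- : (fsize x.1 + fsize x.2)%N = tsize c by rewrite -ychE addnACA.
move: xc; rewrite inE => /predU1P[->|/mapP[q' q'c ->]] /=; first by rewrite /fsize /= !addn0.
by rewrite /fsize /= addn0; exact: IH (mem_head _ _) _ q'c.
Qed.

Lemma pair_cf Y f : pair Y (cf f) = pair Y f.
Proof. by rewrite /pair cfK. Qed.

Lemma pair_cat_cf Y f g : pair Y (cf f ++ cf g) = pair Y (f ++ g).
Proof. by rewrite /pair cf_cat_cf. Qed.

Lemma eq_pair_perm Y f g : perm_eq f g -> pair Y f = pair Y g.
Proof. by move=> fg; rewrite /pair (eq_cf_perm fg). Qed.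

Lemma pair_dunit f : pair (dunit R) f = (f == [::])%:R.
Proof. by rewrite /pair /dunit cf_eq_nil. Qed.

Lemma pair_conv Y Z f :
  pair (conv Y Z) f = \sum_(x <- coprod (cf f)) pair Y x.1 * pair Z x.2.
Proof. by []. Qed.

(** [conv] reads the coproduct of the sorted concatenation, which is a permutation of the
    concatenated sorted pieces; [pair] does not see the difference. *)
Lemma pair_conv_cat Y Z f g :
  pair (conv Y Z) (f ++ g) =
  \sum_(x <- coprod (cf f)) \sum_(y <- coprod (cf g))
     pair Y (x.1 ++ y.1) * pair Z (x.2 ++ y.2).
Proof.
rewrite -(big_coprod_cat (fun x => pair Y x.1 * pair Z x.2)).
apply: (perm_big_coprod (G := fun x => pair Y x.1 * pair Z x.2)).
  by move=> f1 f2 g1 g2 /= /(eq_pair_perm Y) -> /(eq_pair_perm Z) ->.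
rewrite (perm_trans (perm_cf _)) // map_cat perm_sym.
by apply: perm_cat; exact: perm_cf.
Qed.

Lemma coprod_conv_mul (F1 G1 F2 G2 : seq rtree -> R) f g :
  \sum_(x <- coprod f) \sum_(y <- coprod g) F1 x.1 * F2 y.1 * (G1 x.2 * G2 y.2) =
  (\sum_(x <- coprod f) F1 x.1 * G1 x.2) * (\sum_(y <- coprod g) F2 y.1 * G2 y.2).
Proof.
rewrite mulr_suml; apply: eq_bigr => x _; rewrite mulr_sumr.
by apply: eq_bigr => y _; rewrite mulrACA.
Qed.

Definition multiplicative_upto N Y := forall f g, (fsize f + fsize g <= N)%N ->
  pair Y (f ++ g) = pair Y f * pair Y g.

(** The coproduct is multiplicative, and each side of a cut is no larger than the forest being cut,
    so the truncation at [N] is respected. *)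
Lemma conv_multiplicative N Y Z : multiplicative_upto N Y ->
  multiplicative_upto N Z -> multiplicative_upto N (conv Y Z).
Proof.
move=> mY mZ f g fgN; rewrite pair_conv_cat !pair_conv -coprod_conv_mul.
rewrite !big_seq; apply: eq_bigr => -[x1 x2] xf; rewrite !big_seq.
apply: eq_bigr => -[y1 y2] yg.
move: (fsize_coprod xf) (fsize_coprod yg); rewrite !fsize_cf /= => xE yE.
by rewrite mY ?mZ //; lia.
Qed.

(** * Group-like elements *)

(** A functional supported on single trees is an infinitesimal character, a derivation along the
    counit; its convolution powers therefore obey the Leibniz rule, whose induction step is Pascal's
    rule. *)
Lemma cpow_cat (a : dual R) n f g :
  (forall f, size f != 1%N -> pair a f = 0) ->
  pair (cpow a n) (f ++ g) =
  \sum_(k < n.+1) 'C(n, k)%:R * (pair (cpow a k) f * pair (cpow a (n - k)) g).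
Proof.
move=> a_tree.
have a_cat f' g' : pair a (f' ++ g') =
    pair (dunit R) f' * pair a g' + pair a f' * pair (dunit R) g'.
  rewrite !pair_dunit; case: f' => [|u f'] /=.
    by rewrite mul1r (a_tree [::]) // mul0r addr0.
  case: g' => [|v g'] /=; first by rewrite cats0 mul0r add0r mulr1.
  by rewrite mul0r mulr0 addr0 a_tree //= size_cat /= addnS.
elim: n f g => [|n IH] f g.
  rewrite big_ord1 mul1r /= !pair_dunit -natrM mulnb; congr (_ : bool)%:R.
  by case: f.
rewrite /= pair_conv_cat.
have -> : \sum_(x <- coprod (cf f)) \sum_(y <- coprod (cf g))
    pair a (x.1 ++ y.1) * pair (cpow a n) (x.2 ++ y.2) =
    \sum_(k < n.+1) 'C(n, k)%:R *
      (pair (cpow a k) f * pair (cpow a (n - k).+1) g +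
       pair (cpow a k.+1) f * pair (cpow a (n - k)) g).
  under eq_bigr do under eq_bigr do rewrite IH a_cat mulr_sumr.
  under eq_bigr do rewrite exchange_big.
  rewrite exchange_big; apply: eq_bigr => k _ /=.
  (* The factor on which [a] does not act is written as a convolution with the unit, so that both
     factors become sums over cuts. *)
  have dunitl m f' : pair (cpow a m) f' =
     \sum_(x <- coprod (cf f')) pair (dunit R) x.1 * pair (cpow a m) x.2.
    under eq_bigr do rewrite pair_dunit.
    by rewrite (coprod_counitl (pair (cpow a m))) pair_cf.
  rewrite [pair (cpow a k) f]dunitl [pair (cpow a (n - k)) g]dunitl.
  rewrite !pair_conv -!coprod_conv_mul -big_split mulr_sumr /=.
  apply: eq_bigr => x _; rewrite -big_split mulr_sumr /=; apply: eq_bigr => y _.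
  by ring.
under [LHS]eq_bigr do rewrite mulrDr.
rewrite big_split /= big_ord_recl [RHS]big_ord_recl /= !bin0 !subn0 -addrA.
congr (_ + _); under [RHS]eq_bigr do rewrite /bump /= add1n binS natrD mulrDl subSS.
rewrite big_split; congr (_ + _).
rewrite big_ord_recr /= bin_small // mul0r addr0.
by apply: eq_bigr => i _; rewrite -[in RHS](subnSK (ltn_ord i)).
Qed.

(** Each of the [n] factors must consume at least one vertex. *)
Lemma cpow_eq0 (a : dual R) n f : pair a [::] = 0 -> (fsize f < n)%N ->
  pair (cpow a n) f = 0.
Proof.
move=> a0; elim: n f => // n IH f fn; rewrite /= pair_conv big_seq big1 // => -[x1 x2].
move/fsize_coprod; rewrite fsize_cf /= => xf.
have [/eqP|x1_neq0] := eqVneq (fsize x1) 0%N.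
  by rewrite fsize_eq0 => /eqP->; rewrite a0 mul0r.
by rewrite IH ?mulr0 //; lia.
Qed.

Lemma cexp_multiplicative (a : dual R) f g :
  (forall f, size f != 1%N -> pair a f = 0) ->
  pair (cexp a) (f ++ g) = pair (cexp a) f * pair (cexp a) g.
Proof.
move=> a_tree; have a0 : pair a [::] = 0 by exact: a_tree.
have cexpE f' : pair (cexp a) f' =
    \sum_(n < (fsize f').+1) pair (cpow a n) f' / n`!%:R.
  by rewrite {1}/pair /cexp fsize_cf; under eq_bigr do rewrite pair_cf.
(* The exponential series as a polynomial in a formal variable: after division by factorials,
   [cpow_cat] is the Cauchy product of two such polynomials, and evaluation at 1 removes the
   differing truncations. *)
pose P f' := \poly_(n < (fsize f').+1) (pair (cpow a n) f' / n`!%:R).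
have PE f' n : (P f')`_n = pair (cpow a n) f' / n`!%:R.
  by rewrite coef_poly; case: ltnP => // /(cpow_eq0 a0) ->; rewrite mul0r.
have P1 f' m : (fsize f' < m)%N -> (P f').[1] = \sum_(n < m) (P f')`_n.
  move=> fm; rewrite (@horner_coef_wide _ m) ?(leq_trans (size_poly _ _)) //.
  by under eq_bigr do rewrite expr1n mulr1.
have cexpP f' : pair (cexp a) f' = (P f').[1].
  by rewrite cexpE (P1 _ (fsize f').+1) //; under [RHS]eq_bigr do rewrite PE.
rewrite !cexpP -hornerM; congr (_.[1]); apply/polyP => n.
rewrite PE coefM cpow_cat // mulr_suml; apply: eq_bigr => k _; rewrite !PE.
have kn : (k <= n)%N by rewrite -ltnS.
have fact_neq0 m : m`!%:R != 0 :> R by rewrite pnatr_eq0 -lt0n fact_gt0.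
rewrite -(bin_fact kn) !natrM; field.
by rewrite !fact_neq0 pnatr_eq0 -lt0n bin_gt0 kn.
Qed.

Lemma cexp_nil (a : dual R) : pair (cexp a) [::] = 1.
Proof. by rewrite /pair /cexp big_ord1 divr1 pair_dunit eqxx. Qed.

Lemma pair_proj N Y f : pair (proj N Y) f = if (fsize f <= N)%N then pair Y f else 0.
Proof. by rewrite /pair /proj fsize_cf. Qed.

Lemma inG_group_like l N (g : dual R) : inG l N g -> multiplicative_upto N g /\ pair g [::] = 1.
Proof.
case=> a [[a_tree _] gE]; split=> [f f' ff'N|]; last by rewrite gE pair_proj cexp_nil.
rewrite !gE !pair_proj fsize_cat ff'N (leq_trans (leq_addr _ _) ff'N).
rewrite (leq_trans (leq_addl _ _) ff'N) cexp_multiplicative // => f0 f0_size.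
by apply: a_tree; rewrite size_cf negb_and f0_size.
Qed.

(* The recursion [h f = dunit f - sum h x.1 * g x.2] over the cuts with [x.2 <> 1],
   unrolled [n] times, which is enough for forests of size [< n]. *)
Fixpoint linv_rec (g0 : dual R) n (f : seq rtree) : R :=
  if n is n'.+1 then
    (f == [::])%:R -
    \sum_(x <- coprod f | x.2 != [::]) linv_rec g0 n' (cf x.1) * pair g0 x.2
  else 0.

Lemma linv_rec_stable (g0 : dual R) n m f : (fsize f < n)%N -> (fsize f < m)%N ->
  linv_rec g0 n f = linv_rec g0 m f.
Proof.
elim: n m f => // n IH [|m] f //= fn fm; congr (_ - _).
rewrite big_seq_cond [RHS]big_seq_cond; apply: eq_bigr => -[x1 x2] /andP[xf x2_neq0].
move: x2_neq0 (fsize_coprod xf); rewrite -fsize_eq0 /= => x2_neq0 xE.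
by rewrite (IH m) // fsize_cf; lia.
Qed.

Lemma coprod_split_counitr (F : seq rtree -> seq rtree -> R) f :
  \sum_(x <- coprod f) F x.1 x.2 =
  F f [::] + \sum_(x <- coprod f | x.2 != [::]) F x.1 x.2.
Proof.
rewrite (bigID (fun x => x.2 == [::])) /=; congr (_ + _).
rewrite -[RHS](coprod_counitr (fun g => F g [::])) big_mkcond /=.
by apply: eq_bigr => x _; case: eqP => [->|_]; rewrite ?mul1r ?mul0r.
Qed.

Lemma linv_exists N (g0 : dual R) : pair g0 [::] = 1 ->
  exists h, deq (proj N h) h /\ deq (gmul N h g0) (proj N (dunit R)).
Proof.
move=> g1; pose h : dual R := fun f => linv_rec g0 (fsize f).+1 f.
exists (proj N h); split=> f; first by rewrite !pair_proj; case: leqP.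
rewrite !pair_proj; case: leqP => // fN; rewrite pair_dunit -cf_eq_nil.
rewrite pair_conv (coprod_split_counitr (fun x y => pair (proj N h) x * pair g0 y)).
rewrite g1 mulr1 pair_proj fsize_cf fN {1}/pair cfK /h {1}[linv_rec _ _ _]/=.
rewrite -addrA [X in _ + X](_ : _ = 0) ?addr0 //; apply/eqP.
rewrite addrC subr_eq0 big_seq_cond [X in _ == X]big_seq_cond; apply/eqP.
apply: eq_bigr => -[x1 x2] /andP[xf x2_neq0].
move: x2_neq0 (fsize_coprod xf); rewrite -fsize_eq0 fsize_cf /= => x2_neq0 xE.
rewrite pair_proj ifT; last by lia.
congr (_ * _); apply: (@linv_rec_stable _ (fsize (cf x1)).+1) => //.
by rewrite fsize_cf; lia.
Qed.

(** [ginv] is an [epsilon] choice, so its specification holds only once a truncated left inverse has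
    been constructed. *)
Lemma ginvP N (g0 : dual R) : pair g0 [::] = 1 ->
  deq (gmul N (ginv N g0) g0) (proj N (dunit R)).
Proof.
move=> /(linv_exists N) h_ex.
by have [] := epsilon_spec (inhabits (fun _ => 0 : R)) _ h_ex.
Qed.

(* Comparing [h * g0] with the unit on a product [f g], every cut but the trivial
   one has a strictly smaller left part, so multiplicativity of [h] follows by
   induction on the size. *)
Lemma linv_multiplicative N (g0 h : dual R) : multiplicative_upto N g0 -> pair g0 [::] = 1 ->
  deq (gmul N h g0) (proj N (dunit R)) -> multiplicative_upto N h.
Proof.
move=> mg g1 hg f g; move En : (fsize f + fsize g)%N => n.
elim/ltn_ind: n f g En => n IH f g En nN.
have conv_hg f' : (fsize f' <= N)%N -> pair (conv h g0) f' = (f' == [::])%:R.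
  by move=> f'N; move: (hg f'); rewrite !pair_proj f'N pair_dunit.
have fN : (fsize f <= N)%N by lia.
have gN : (fsize g <= N)%N by lia.
have : pair (conv h g0) (f ++ g) = pair (conv h g0) f * pair (conv h g0) g.
  rewrite !conv_hg ?fsize_cat ?En // -natrM mulnb; congr (_ : bool)%:R.
  by case: f {En fN}.
pose D x y := pair h (x ++ y) - pair h x * pair h y.
move/eqP; rewrite -subr_eq0 pair_conv_cat !pair_conv -coprod_conv_mul => /eqP hfg0.
apply/eqP; rewrite -subr_eq0; apply/eqP; rewrite -[RHS]hfg0.
(* The counit identities spread the defect [D] over all pairs of cuts, so that it can be compared
   with the convolutions term by term. *)
transitivity (\sum_(x <- coprod (cf f)) (x.2 == [::])%:R *
    \sum_(y <- coprod (cf g)) (y.2 == [::])%:R * D x.1 y.1).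
  rewrite (coprod_counitr (fun x => \sum_(y <- coprod (cf g)) (y.2 == [::])%:R * D x y.1)).
  by rewrite (coprod_counitr (D (cf f))) /D !pair_cf pair_cat_cf.
rewrite -sumrB !big_seq; apply: eq_bigr => -[x1 x2] xf; rewrite -sumrB mulr_sumr !big_seq.
apply: eq_bigr => -[y1 y2] yg.
move: (fsize_coprod xf) (fsize_coprod yg); rewrite !fsize_cf /= => xE yE.
have [xy2|xy2] := posnP (fsize x2 + fsize y2).
  have /eqP : fsize x2 = 0%N by lia.
  have /eqP : fsize y2 = 0%N by lia.
  by rewrite !fsize_eq0 => /eqP-> /eqP->; rewrite g1 !mul1r !mulr1.
rewrite mulrA -natrM mulnb -!fsize_eq0 -addn_eq0.
rewrite eqn0Ngt xy2 mul0r mg ?(IH (fsize x1 + fsize y1)%N) //; try lia.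
by rewrite subrr.
Qed.

Lemma incr_multiplicative l p T (X : R -> dual R) s t :
  branched_rough_path l p T X -> 0 <= s <= T -> 0 <= t <= T ->
  multiplicative_upto (ip p) (incr p X s t).
Proof.
move=> [XG _] sT tT f g fgN.
have [ms s1] := inG_group_like (XG s sT); have [mt t1] := inG_group_like (XG t tT).
rewrite /incr /gmul !pair_proj fsize_cat fgN (leq_trans (leq_addr _ _) fgN).
rewrite (leq_trans (leq_addl _ _) fgN); apply: conv_multiplicative fgN => //.
by apply: linv_multiplicative (ginvP _ _).
Qed.

(** The rough path bound is stated for s < t, while solutions are tested for s <= t; this settles
    the diagonal. *)
Lemma incr_refl l p T (X : R -> dual R) s f :
  branched_rough_path l p T X -> 0 <= s <= T -> f != [::] ->
  pair (incr p X s s) f = 0.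
Proof.
move=> [XG _] sT f0; have [ms s1] := inG_group_like (XG s sT).
by rewrite /incr (ginvP (ip p) s1) pair_proj pair_dunit (negPf f0); case: ifP.
Qed.

End CoproductSums.
(** * The basis of forests and multinomial counting *)

(** Splitting off the first tree leaves its children and the remaining trees, both of size less than
    [n], so fuel [n] is enough. *)
Lemma mem_raw_forests l m n (f : seq rtree) : (n <= m)%N ->
  (f \in raw_forests l m n) = all (wft l) f && (fsize f == n).
Proof.
have base0 k (g : seq rtree) : (g \in raw_forests l k 0) = all (wft l) g && (fsize g == 0%N).
  by rewrite fsize_eq0; case: k => [|k]; rewrite inE andb_idl // => /eqP->.
elim: m n f => [|m IH] [|n] f nm //.
apply/flatten_mapP/idP => [[k]|].
  rewrite mem_iota => k_bounds /flatten_mapP[a]; rewrite mem_iota add0n => /andP[_ a_lt].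
  case/allpairsP => -[g h] [/= gk hk ->].
  rewrite IH in gk; last by lia.
  rewrite IH in hk; last by lia.
  case/andP: gk => g_wft /eqP g_size; case/andP: hk => h_wft /eqP h_size.
  rewrite /= a_lt g_wft h_wft fsize_cons /= -/(fsize g) g_size h_size; lia.
case: f => [|[[]|a g] h] // /andP[/= /andP[/andP[a_lt g_wft] h_wft]].
rewrite fsize_cons [tsize _]/= -/(fsize g) => /eqP f_size.
exists (fsize g).+1; first by rewrite -/(iota 1 n.+1) mem_iota; lia.
apply/flatten_mapP; exists a; first by rewrite mem_iota add0n.
by apply/allpairsP; exists (g, h); split => //=; rewrite IH ?g_wft ?h_wft //=; lia.
Qed.

Lemma mem_basis_upto l N f : (f \in basis_upto l N) =
  [&& cf f == f, all (wft l) f, (0 < fsize f)%N & (fsize f <= N)%N].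
Proof.
rewrite mem_undup; apply/allpairsPdep/and4P => [[n [g [n_bounds]]]|[/eqP ff wf f0 fN]].
  rewrite mem_iota in n_bounds; rewrite mem_raw_forests // => /andP[g_wft /eqP g_size] ->.
  by rewrite cfK all_wft_cf fsize_cf eqxx g_size; split=> //; lia.
exists (fsize f), f; rewrite mem_iota mem_raw_forests // wf eqxx ff; split=> //; lia.
Qed.

Lemma basis_upto_uniq l N : uniq (basis_upto l N).
Proof. exact: undup_uniq. Qed.

Definition trees_upto l N : seq rtree :=
  [seq head (GenTree.Node 0 [::]) f | f <- basis_upto l N & size f == 1%N].

Lemma mem_trees_upto l N u : (u \in trees_upto l N) = ([:: u] \in basis_upto l N).
Proof.
apply/mapP/idP => [[f]|uN]; last by exists [:: u]; rewrite ?mem_filter.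
by rewrite mem_filter => /andP[]; case: f => [|v []] //= _ vN ->.
Qed.

Lemma trees_upto_uniq l N : uniq (trees_upto l N).
Proof.
rewrite map_inj_in_uniq ?filter_uniq ?basis_upto_uniq // => f g.
rewrite !mem_filter => /andP[f1 _] /andP[g1 _].
by case: f g f1 g1 => [|u []] // [|v []] //= _ _ ->.
Qed.

Lemma big_trees_upto (V : nmodType) l N (F : seq rtree -> V) :
  \sum_(f <- basis_upto l N | size f == 1%N) F f = \sum_(u <- trees_upto l N) F [:: u].
Proof. by rewrite big_map big_filter; apply: eq_bigr => -[|u []]. Qed.

Lemma trees_uptoP l N u : u \in trees_upto l N ->
  [/\ canon u = u, wft l u & (tsize u <= N)%N].
Proof.
rewrite mem_trees_upto mem_basis_upto cf1 /fsize /= addn0 andbT.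
by case/and4P => /eqP[].
Qed.

Lemma all_trees_upto l N f : f \in basis_upto l N -> all (mem (trees_upto l N)) f.
Proof.
rewrite mem_basis_upto => /and4P[/eqP ff wf _ fN]; apply/allP => u uf.
rewrite /= mem_trees_upto mem_basis_upto cf1 /= andbT (allP wf _ uf) /fsize /= addn0 tsize_gt0.
have -> : canon u = u.
  by move: uf; rewrite -ff mem_sort => /mapP[v _ ->]; rewrite canonK.
rewrite eqxx /= (leq_trans _ fN) // /fsize.
by rewrite (perm_sumn (perm_map tsize (perm_to_rem uf))) /= leq_addr.
Qed.

Fixpoint words (T : Type) (s : seq T) n : seq (seq T) :=
  if n is n'.+1 then [seq u :: t | u <- s, t <- words s n'] else [:: [::]].

Lemma big_words (V : nmodType) (T : Type) (s : seq T) n (F : seq T -> V) :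
  \sum_(t <- words s n.+1) F t = \sum_(u <- s) \sum_(t <- words s n) F (u :: t).
Proof.
rewrite -[words s n.+1]/[seq u :: t | u <- s, t <- words s n].
by rewrite big_allpairs_dep.
Qed.

Lemma mem_words (T : eqType) (s : seq T) n t :
  (t \in words s n) = (size t == n) && all (mem s) t.
Proof.
elim: n t => [|n IH] t; first by case: t.
apply/allpairsP/idP => [[[u w] [/= us]]|]; first by rewrite IH => ? ->; rewrite /= eqSS us.
case: t => // u w /=; rewrite eqSS => /and3P[wn us ws].
by exists (u, w); rewrite /= IH wn ws.
Qed.

Lemma sum_count_mem (T : eqType) (s f : seq T) : uniq s -> all (mem s) f ->
  (\sum_(u <- s) count_mem u f)%N = size f.
Proof.
move=> s_uniq; elim: f => [|v f IH] /=; first by rewrite big1.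
case/andP=> vs fs; rewrite big_split /= IH // (bigD1_seq v) //= eqxx.
by rewrite big1 // => u /negPf uv; rewrite eq_sym uv.
Qed.

(** The multinomial coefficient, written without division. The induction is on the first letter [u]:
    the words starting with [u] spell [rem u f], and n! splits into the multiplicities of the
    letters times (n-1)!. *)
Lemma count_perm_words (T : eqType) (s f : seq T) n :
  uniq s -> all (mem s) f -> size f = n ->
  (count (perm_eq f) (words s n) * \prod_(u <- s) (count_mem u f)`!)%N = n`!.
Proof.
move=> s_uniq; elim: n f => [|n IH] f fs fn.
  by case: f fn {fs} => // _; rewrite big1.
rewrite -sum1_count big_mkcond big_words big_distrl /=.
rewrite factS -fn -(sum_count_mem s_uniq fs) big_distrl /=; apply: eq_big_seq => u us.
have [uf|uf] := boolP (u \in f); last first.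
  rewrite (count_memPn uf) mul0n big1 // => t _; case: ifP => // /perm_mem/(_ u).
  by rewrite (negPf uf) inE eqxx.
have prem := perm_to_rem uf.
have -> : (\sum_(t <- words s n) if perm_eq f (u :: t) then 1 else 0)%N =
    count (perm_eq (rem u f)) (words s n).
  rewrite -sum1_count [RHS]big_mkcond /=; apply: eq_bigr => t _.
  by rewrite (permPl prem) perm_cons.
have fs' : all (mem s) (rem u f) by apply/allP => v /mem_rem; exact: (allP fs).
have fn' : size (rem u f) = n by rewrite size_rem // fn.
have countE v : count_mem v f = ((u == v) + count_mem v (rem u f))%N.
  by rewrite (permP prem).
rewrite -(IH _ fs' fn') mulnCA; congr (_ * _)%N.
rewrite (bigD1_seq u) //= [in RHS](bigD1_seq u) //= mulnA; congr (_ * _)%N.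
  by rewrite !countE eqxx add1n factS.
by apply: eq_bigr => v /negPf vu; rewrite countE eq_sym vu.
Qed.

Lemma mult_factE (s f : seq rtree) : uniq s -> all (mem s) f -> map canon f = f ->
  mult_fact f = (\prod_(u <- s) (count_mem u f)`!)%N.
Proof.
move=> s_uniq fs ff; rewrite /mult_fact ff foldrE big_map.
rewrite [RHS](bigID (mem f)) /= [X in (_ * X)%N]big1 ?muln1 => [|u /count_memPn->] //.
rewrite -[RHS]big_filter; apply: perm_big.
apply: uniq_perm; rewrite ?undup_uniq ?filter_uniq // => u.
by rewrite mem_undup mem_filter andb_idr // => /(allP fs).
Qed.

Lemma mult_fact_gt0 f : (0 < mult_fact f)%N.
Proof. by rewrite /mult_fact foldrE big_map prodn_gt0 // => u; exact: fact_gt0. Qed.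

Lemma sum_words_forests (R : realType) l N n (G : seq rtree -> R) : (0 < n)%N ->
  {in words (trees_upto l N) n &, forall t t', perm_eq t t' -> G t = G t'} ->
  \sum_(t <- words (trees_upto l N) n | (fsize t <= N)%N) G t =
  \sum_(f <- basis_upto l N | size f == n) n`!%:R / (mult_fact f)%:R * G f.
Proof.
move=> n0 Gperm; set S := trees_upto l N.
have Suniq := trees_upto_uniq l N.
(* In the double sum over forests and words, summing over words first gives the multinomial count;
   summing over forests first leaves only [cf t], which lies in the basis exactly when [t] has at
   most [N] vertices. *)
transitivity (\sum_(f <- basis_upto l N | size f == n)
    \sum_(t <- words S n) (perm_eq f t)%:R * G t); last first.
  rewrite big_seq_cond [RHS]big_seq_cond; apply: eq_bigr => f /andP[fN /eqP fn].
  have fS := all_trees_upto fN.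
  have ff : map canon f = f.
    by move: fN; rewrite mem_basis_upto => /and4P[/eqP <- _ _ _]; rewrite map_canon_cf.
  have fW : f \in words S n by rewrite mem_words fn eqxx.
  rewrite -(count_perm_words Suniq fS fn) natrM -(mult_factE Suniq fS ff) mulfK; last first.
    by rewrite pnatr_eq0 -lt0n mult_fact_gt0.
  rewrite -sum1_count natr_sum big_distrl /= [RHS]big_mkcond /=.
  apply: eq_big_seq => t tW; case: ifP => [ft|_]; last by rewrite mul0r.
  by rewrite !mul1r (Gperm _ _ fW tW ft).
rewrite exchange_big big_mkcond; apply: eq_big_seq => t /=.
rewrite mem_words => /andP[/eqP tn tS].
have tt : map canon t = t.
  rewrite -[RHS]map_id; apply/eq_in_map => u ut.
  by have [] := trees_uptoP (allP tS _ ut).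
have t_wft : all (wft l) t by apply/allP => u /(allP tS) /trees_uptoP[].
have t0 : (0 < fsize t)%N by rewrite (leq_trans _ (size_le_fsize t)) // tn.
have permE f : f \in basis_upto l N -> perm_eq f t = (f == cf t).
  rewrite mem_basis_upto => /and4P[/eqP ff _ _ _]; apply/idP/eqP => [/eq_cf_perm <-//|->].
  by rewrite (perm_trans (perm_cf _)) // tt.
case: leqP => tN; last first.
  rewrite big_seq_cond big1 // => f /andP[fN _].
  rewrite permE //; case: eqP => [fE|_]; last by rewrite mul0r.
  move: fN; rewrite mem_basis_upto => /and4P[_ _ _].
  by rewrite fE fsize_cf leqNgt tN.
have cftN : cf t \in basis_upto l N.
  by rewrite mem_basis_upto cfK eqxx all_wft_cf t_wft fsize_cf t0.
rewrite big_mkcond (bigD1_seq (cf t)) ?basis_upto_uniq //= size_cf tn eqxx permE // eqxx mul1r.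
rewrite big_seq_cond big1 ?addr0 // => f /andP[fN /negPf ft].
by rewrite permE // ft mul0r if_same.
Qed.

(** * Mean value arguments along lines *)

Section Lines.
Local Open Scope classical_set_scope.
Variables (R : realType) (V : normedModType R).
Implicit Types (f : V -> R^o) (x v w : V).

(** The sign of [h] is free because difference quotients approach 0 from both sides. *)
Lemma MVT_from0 (g dg : R -> R) (h : R) :
  (forall t : R, is_derive t (1 : R) g (dg t)) ->
  exists2 c : R, `|c| <= `|h| & g h - g 0 = h * dg c.
Proof.
move=> gd.
have gc (a b : R) : {within `[a, b], continuous g}.
  apply: continuous_subspaceT => t; apply: differentiable_continuous.
  exact/derivable1_diffP/ex_derive.
have [h0|h0] := leP 0 h.
  have [c] := MVT_segment h0 (fun t _ => gd t) (gc 0 h).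
  rewrite in_itv /= subr0 => /andP[c0 ch] gE; exists c; last by rewrite gE mulrC.
  by rewrite !ger0_norm.
have [c] := MVT_segment (ltW h0) (fun t _ => gd t) (gc h 0).
rewrite in_itv /= sub0r => /andP[ch c0] gE; exists c.
  by rewrite ler0_norm // ltr0_norm // lerN2.
by rewrite -opprB gE mulrN opprK mulrC.
Qed.

Lemma is_derive_line f x v (t : R) : derivable f (x + t *: v) v ->
  is_derive t (1 : R) (fun s => f (x + s *: v)) ('D_v f (x + t *: v)).
Proof.
have eqf : (fun h : R => h^-1 *: (((fun s => f (x + s *: v)) \o shift t) (h *: (1 : R))
      - f (x + t *: v))) =
    (fun h : R => h^-1 *: ((f \o shift (x + t *: v)) (h *: v) - f (x + t *: v))).
  by apply/funext => h /=; rewrite [_ *: 1]mulr1 scalerDl addrCA.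
by move=> df; split; rewrite ?/derivable ?/derive eqf.
Qed.

Lemma MVT_line f x v (h : R) : (forall y, derivable f y v) ->
  exists2 c : R, `|c| <= `|h| & f (x + h *: v) - f x = h * 'D_v f (x + c *: v).
Proof.
move=> df; have [c ch fE] := MVT_from0 h (fun t => is_derive_line (df (x + t *: v))).
by exists c => //; rewrite -fE scale0r addr0.
Qed.

Lemma cvg_near0 (p : R -> V) x (M : R) : (forall k, `|p k - x| <= `|k| * M) ->
  p @ 0^' --> x.
Proof.
move=> pM; apply/cvgrPdist_lt => e e0.
have M1 : 0 < `|M| + 1 by rewrite ltr_wpDl.
near=> k; rewrite distrC (le_lt_trans (pM k)) //.
rewrite (@le_lt_trans _ _ (`|k| * (`|M| + 1))) //.
  by rewrite ler_wpM2l // (le_trans (ler_norm _)) // lerDl.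
by rewrite -ltr_pdivlMr //; near: k; apply: dnbhs0_lt; rewrite divr_gt0.
Unshelve. all: by end_near. Qed.

(** Serves to compare two mean value formulas for the same quantity whose intermediate points differ
    but both tend to [x]. *)
Lemma eq_lim_near0 (A B : V -> R^o) x (p q : R -> V) (M M' : R) :
  continuous A -> continuous B ->
  (forall k, `|p k - x| <= `|k| * M) -> (forall k, `|q k - x| <= `|k| * M') ->
  (forall k, k != 0 -> A (p k) = B (q k)) -> A x = B x.
Proof.
move=> cA cB pM qM AB.
have px : (fun k => A (p k)) @ 0^' --> A x.
  exact: (cvg_comp _ _ (cvg_near0 pM) (cA x)).
have qx : (fun k => B (q k)) @ 0^' --> B x.
  exact: (cvg_comp _ _ (cvg_near0 qM) (cB x)).
rewrite -(cvg_lim _ px) //; apply: cvg_lim => //; apply: cvg_trans qx.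
apply: near_eq_cvg; near=> k; rewrite AB //.
by near: k; exact: nbhs_dnbhs_neq.
Unshelve. all: by end_near. Qed.

(** The increment along [k *: (a *: v + w)] is split into a leg along [v] and a leg along [w]. The
    mean value theorem on each leg and continuity of the two partial derivatives give the limit. *)
Lemma derive_comb f (a : R) v w x : (forall y u, derivable f y u) ->
  continuous ('D_v f : V -> R^o) -> continuous ('D_w f : V -> R^o) ->
  'D_(a *: v + w) f x = a * 'D_v f x + 'D_w f x.
Proof.
move=> df cv cw.
have /choice[p p_spec] : forall k : R, exists y, `|y - x| <= `|k| * (`|a| * `|v| + `|w|) /\
    f (x + (k * a) *: v + k *: w) - f (x + (k * a) *: v) = k * 'D_w f y.
  move=> k; have [c ck fE] := MVT_line (x + (k * a) *: v) k (fun y => df y w).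
  exists (x + (k * a) *: v + c *: w); split=> //.
  rewrite addrAC [x + _ - x]addrAC subrr add0r (le_trans (ler_normD _ _)) // !normrZ.
  by rewrite mulrDr mulrA lerD // ler_wpM2r.
have /choice[q q_spec] : forall k : R, exists y, `|y - x| <= `|k| * (`|a| * `|v|) /\
    f (x + (k * a) *: v) - f x = (k * a) * 'D_v f y.
  move=> k; have [c ck fE] := MVT_line x (k * a) (fun y => df y v).
  exists (x + c *: v); split=> //.
  by rewrite addrC addKr normrZ mulrA ler_wpM2r // -normrM.
have px := cvg_near0 (fun k => (p_spec k).1).
have qx := cvg_near0 (fun k => (q_spec k).1).
apply: cvg_lim => //.
apply: (@cvg_trans _ ((fun k => a * 'D_v f (q k) + 'D_w f (p k)) @ 0^')).
  apply: near_eq_cvg; near=> k.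
  have k0 : k != 0 by near: k; exact: nbhs_dnbhs_neq.
  rewrite /= [k *: _]scalerDr scalerA [_ + x]addrC addrA.
  have -> : f (x + (k * a) *: v + k *: w) - f x = k * (a * 'D_v f (q k) + 'D_w f (p k)).
    by rewrite -(subrKA (f (x + (k * a) *: v))) (p_spec k).2 (q_spec k).2; ring.
  by rewrite /GRing.scale /= mulKf.
have Dp : (fun k => 'D_w f (p k) : R^o) @ 0^' --> ('D_w f x : R^o).
  exact: (cvg_comp _ _ px (cw x)).
have Dq : (fun k => 'D_v f (q k) : R^o) @ 0^' --> ('D_v f x : R^o).
  exact: (cvg_comp _ _ qx (cv x)).
by apply: cvgD Dp; apply: cvgMl_tmp Dq.
Unshelve. all: by end_near. Qed.

(** Schwarz's argument: the second difference of [f] is symmetric in the two directions, and two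
    applications of the mean value theorem express it through either mixed derivative at a point
    close to [x]. *)
Lemma derive_comm f v w x :
  (forall y, derivable f y v) -> (forall y, derivable f y w) ->
  (forall y, derivable ('D_v f : V -> R^o) y w) ->
  (forall y, derivable ('D_w f : V -> R^o) y v) ->
  continuous ('D_w ('D_v f : V -> R^o) : V -> R^o) ->
  continuous ('D_v ('D_w f : V -> R^o) : V -> R^o) ->
  'D_w ('D_v f : V -> R^o) x = 'D_v ('D_w f : V -> R^o) x.
Proof.
move=> dv dw dvw dwv cvw cwv.
have second_diff u u' (h : R) : (forall y, derivable f y u) ->
    (forall y, derivable ('D_u f : V -> R^o) y u') ->
    exists y, `|y - x| <= `|h| * (`|u| + `|u'|) /\
    (f (x + h *: u' + h *: u) - f (x + h *: u)) - (f (x + h *: u') - f x) =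
    h * (h * 'D_u' ('D_u f : V -> R^o) y).
  move=> du duu.
  have [c ch cE] := MVT_from0 h (fun t => @is_deriveB _ _ R^o _ _ _ _ _ _
    (is_derive_line (du (x + h *: u' + t *: u))) (is_derive_line (du (x + t *: u)))).
  have [c' c'h c'E] := MVT_line (x + c *: u) h duu.
  exists (x + c *: u + c' *: u'); split.
    rewrite addrAC [x + _ - x]addrAC subrr add0r (le_trans (ler_normD _ _)) // !normrZ.
    by rewrite mulrDr lerD // ler_wpM2r.
  have -> : f (x + h *: u') - f x = f (x + h *: u' + 0 *: u) - f (x + 0 *: u).
    by rewrite scale0r !addr0.
  by rewrite -c'E [x + c *: u + _]addrAC; exact: cE.
have /choice[p p_spec] := fun h => second_diff v w h dv dvw.
have /choice[q q_spec] := fun h => second_diff w v h dw dwv.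
apply: (eq_lim_near0 cvw cwv (fun k => (p_spec k).1) (fun k => (q_spec k).1)) => h h0.
suff E : h * (h * 'D_w ('D_v f : V -> R^o) (p h)) = h * (h * 'D_v ('D_w f : V -> R^o) (q h)) :> R.
  exact: (mulfI h0 (mulfI h0 E)).
have [[_ pE] [_ qE]] := (p_spec h, q_spec h).
apply: etrans (esym pE) (etrans _ qE); rewrite [x + h *: v + _]addrAC.
by move: (f _) (f _) (f _) (f _) => a b c e; rewrite !opprB addrACA [RHS]addrACA [- b + _]addrC.
Qed.

End Lines.
(** * Iterated directional derivatives *)

#[local] Arguments Dn {R d W} f vs _ : simpl never.

Section IteratedDerivatives.
Variables (R : realType) (d : nat).
Local Notation E := 'rV[R]_d.
Implicit Types (f : E -> R^o) (v w x y : E) (vs ws : seq E).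

Lemma coord_le_norm v i : `|v ord0 i| <= `|v|.
Proof. by rewrite [leRHS]/Num.Def.normr /= mx_normrE; exact: (le_bigmax _ _ (ord0, i)). Qed.

Lemma Dn_cons (W : normedModType R) (f : E -> W) v vs :
  Dn f (v :: vs) = fun x => 'D_v (Dn f vs) x.
Proof. by []. Qed.

Lemma Ck_continuous (W : normedModType R) (f : E -> W) k vs :
  Ck f k -> (size vs <= k)%N -> continuous (Dn f vs).
Proof. by move=> fk /fk[]. Qed.

Lemma Ck_derivable (W : normedModType R) (f : E -> W) k vs x v :
  Ck f k -> (size vs < k)%N -> derivable (Dn f vs) x v.
Proof. by move=> fk vsk; apply: (fk vs (ltnW vsk)).2. Qed.

Lemma Dn_swap f k v w vs : Ck f k -> ((size vs).+2 <= k)%N ->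
  Dn f (v :: w :: vs) = Dn f (w :: v :: vs).
Proof.
move=> fk vsk; apply/funext => x; apply: derive_comm.
- by move=> y; apply: Ck_derivable fk _; apply: ltnW.
- by move=> y; apply: Ck_derivable fk _; apply: ltnW.
- by move=> y; exact: (@Ck_derivable _ f k (w :: vs) y v fk vsk).
- by move=> y; exact: (@Ck_derivable _ f k (v :: vs) y w fk vsk).
- exact: (@Ck_continuous _ f k (v :: w :: vs) fk vsk).
- exact: (@Ck_continuous _ f k (w :: v :: vs) fk vsk).
Qed.

Lemma Dn_move f k v vs ws : Ck f k -> (size (v :: vs ++ ws) <= k)%N ->
  Dn f (v :: vs ++ ws) = Dn f (vs ++ v :: ws).
Proof.
move=> fk; elim: vs => [//|w vs IH] vsk.
rewrite cat_cons (Dn_swap _ _ fk) // [RHS]Dn_cons -IH //; exact: ltnW.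
Qed.

Lemma Dn_perm f k vs ws : Ck f k -> (size vs <= k)%N -> perm_eq vs ws ->
  Dn f vs = Dn f ws.
Proof.
move=> fk; elim: vs ws => [|v vs IH] ws vsk vsws.
  by have /eqP := perm_size vsws; rewrite eq_sym size_eq0 => /eqP->.
have vws : v \in ws by rewrite -(perm_mem vsws) mem_head.
move: vsws; case/splitPr: vws vsk => ws1 ws2 vsk.
rewrite perm_sym -[v :: ws2]cat1s perm_catCA /= perm_cons perm_sym => vsws.
rewrite -(Dn_move fk) ?Dn_cons -?(IH _ (ltnW vsk) vsws) //.
by rewrite /= -(perm_size vsws).
Qed.

Lemma Dn_comb f k (a : R) v w vs x : Ck f k -> (size vs < k)%N ->
  Dn f (a *: v + w :: vs) x = a * Dn f (v :: vs) x + Dn f (w :: vs) x.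
Proof.
move=> fk vsk; apply: derive_comb.
- by move=> y u; apply: Ck_derivable fk vsk.
- exact: (@Ck_continuous _ f k (v :: vs) fk vsk).
- exact: (@Ck_continuous _ f k (w :: vs) fk vsk).
Qed.

Lemma Dn_zero f k vs x : Ck f k -> (size vs < k)%N -> Dn f (0 :: vs) x = 0.
Proof.
move=> fk vsk; have := Dn_comb (-1) 0 0 x fk vsk.
by rewrite scaler0 addr0 mulN1r addNr.
Qed.

Lemma Dn_sum f k (I : Type) (r : seq I) (c : I -> R) (w : I -> E) vs x :
  Ck f k -> (size vs < k)%N ->
  Dn f (\sum_(i <- r) c i *: w i :: vs) x = \sum_(i <- r) c i * Dn f (w i :: vs) x.
Proof.
move=> fk vsk; elim: r => [|i r IH]; first by rewrite !big_nil (Dn_zero _ fk).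
by rewrite !big_cons (Dn_comb _ _ _ _ fk vsk) IH.
Qed.

(** The tail [vs] makes the induction possible: linearity is available in the head slot only, so
    each expanded slot is moved behind the unexpanded ones. *)
Lemma Dn_words f k (I : eqType) (r : seq I) (c : I -> R) (w : I -> E) n vs x :
  Ck f k -> (n + size vs <= k)%N ->
  Dn f (nseq n (\sum_(i <- r) c i *: w i) ++ vs) x =
  \sum_(t <- words r n) (\prod_(i <- t) c i) * Dn f (map w t ++ vs) x.
Proof.
move=> fk; elim: n vs => [|n IH] vs nk; first by rewrite big_seq1 big_nil mul1r.
rewrite big_words /= (Dn_sum _ _ _ _ fk) ?size_cat ?size_nseq //.
apply: eq_bigr => i _; rewrite (Dn_move fk) /= ?size_cat ?size_nseq //.
rewrite IH /= ?addnS // mulr_sumr !big_seq; apply: eq_bigr => t.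
rewrite mem_words => /andP[/eqP tn _]; rewrite big_cons mulrA.
by rewrite -(Dn_move fk) //= size_cat size_map tn.
Qed.

Lemma Dn_scale f k (I : Type) (s : seq I) (c : I -> R) (w : I -> E) vs x :
  Ck f k -> (size s + size vs <= k)%N ->
  Dn f ([seq c i *: w i | i <- s] ++ vs) x =
  (\prod_(i <- s) c i) * Dn f (map w s ++ vs) x.
Proof.
move=> fk; elim: s vs => [|i s IH] vs sk; first by rewrite big_nil mul1r.
have ssk : (size (map (fun i => c i *: w i) s ++ vs) < k)%N by rewrite size_cat size_map.
rewrite map_cons cat_cons -[c i *: w i]addr0 (Dn_comb _ _ _ _ fk ssk) (Dn_zero _ fk ssk) addr0.
rewrite (Dn_move fk) //= IH /= ?addnS // big_cons mulrA -(Dn_move fk) //=.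
by rewrite size_cat size_map.
Qed.

Lemma continuous_bounded_ball (g : E -> R^o) (M : R) : continuous g ->
  exists2 B : R, 0 <= B & forall x, `|x| <= M -> `|g x| <= B.
Proof.
move=> cg; have cball : compact [set x : E | `|x| <= M]%classic.
  apply: bounded_closed_compact.
    by exists M; split; [exact: num_real|move=> r Mr x /= xM; exact: le_trans xM (ltW Mr)].
  by apply: (@preimage_closed _ _ (fun x : E => `|x|) [set r | r <= M]%classic);
    [move=> x _; exact: norm_continuous|exact: closed_le].
have /compact_bounded[B [_ gB]] := continuous_compact (continuous_subspaceT cg) cball.
exists (`|B| + 1) => [|x xM]; first by rewrite addr_ge0.
by apply: gB; [rewrite (le_lt_trans (ler_norm B)) // ltrDl|exists x].
Qed.

(** Uniformity in [vs] comes from expanding each vector in the standard basis: basis vectors collect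
    in [ws], and only finitely many continuous functions of [x] remain to be bounded. *)
Lemma Dn_bounded f k n ws (M : R) : Ck f k -> (n + size ws <= k)%N ->
  exists2 B : R, 0 <= B & forall vs x, size vs = n -> `|x| <= M ->
    `|Dn f (vs ++ ws) x| <= B * \prod_(v <- vs) `|v|.
Proof.
move=> fk; elim: n ws => [|n IH] ws nk.
  have [B B0 fB] := continuous_bounded_ball M (Ck_continuous fk nk).
  by exists B => // -[|//] x _ xM; rewrite big_nil mulr1; exact: fB.
have /choice[B B_spec] : forall i : 'I_d, exists B : R, 0 <= B /\
    forall vs x, size vs = n -> `|x| <= M ->
    `|Dn f (vs ++ delta_mx ord0 i :: ws) x| <= B * \prod_(v <- vs) `|v|.
  by move=> i; have [|B B0 fB] := IH (delta_mx ord0 i :: ws); [rewrite /= addnS|exists B].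
exists (\sum_i B i) => [|[//|v vs] x [vsn] xM].
  by apply: sumr_ge0 => i _; exact: (B_spec i).1.
have vsk : (size (vs ++ ws) < k)%N by rewrite size_cat vsn.
rewrite {1}[v]row_sum_delta cat_cons (Dn_sum _ _ _ _ fk vsk).
rewrite (le_trans (ler_norm_sum _ _ _)) // big_cons mulrCA mulr_suml mulr_sumr.
apply: ler_sum => i _; rewrite (Dn_move fk) // normrM.
apply: ler_pM => //; first exact: coord_le_norm.
exact: (B_spec i).2.
Qed.

Lemma Dn_lipschitz f k n (M : R) : Ck f k -> (n < k)%N ->
  exists2 B : R, 0 <= B & forall vs x y, size vs = n -> `|x| <= M -> `|y| <= M ->
    `|Dn f vs x - Dn f vs y| <= B * (\prod_(v <- vs) `|v|) * `|x - y|.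
Proof.
move=> fk nk.
have nk' : (n.+1 + size ([::] : seq E) <= k)%N by rewrite addn0.
(* The intermediate point is y + c(x - y) with |c| <= 1, where [c] may be negative, so its norm is
   at most M + 2M. *)
have [B B0 fB] := Dn_bounded (M + (M + M)) fk nk'.
exists B => // vs x y vsn xM yM.
have vsk : (size vs < k)%N by rewrite vsn.
have [c c1 cE] := MVT_line y 1 (fun u => @Ck_derivable _ f k vs u (x - y) fk vsk).
move: cE; rewrite scale1r mul1r [y + _]addrC subrK => ->.
have := fB (x - y :: vs) (y + c *: (x - y)); rewrite cats0 big_cons => fBc.
apply: le_trans (fBc _ _) _; [by rewrite /= vsn| |by rewrite mulrCA mulrC].
rewrite (le_trans (ler_normD _ _)) // lerD // normrZ.
rewrite (@le_trans _ _ (1 * `|x - y|)) //.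
  by rewrite ler_wpM2r // (le_trans c1) // normr1.
by rewrite mul1r (le_trans (ler_normB _ _)) // lerD.
Qed.

(** The remainder is controlled by the oscillation of the last derivative, since a further
    derivative need not exist. The derivative of the remainder is the remainder of the shifted
    family, and the remainder vanishes at 0, so the mean value theorem carries the bound up. *)
Lemma taylor_bound (g : nat -> R -> R) N (K : R) :
  (forall n, (n < N)%N -> forall t : R, is_derive t (1 : R) (g n) (g n.+1 t)) ->
  (forall t, `|t| <= 1 -> `|g N t - g N 0| <= K) ->
  forall t, `|t| <= 1 -> `|g 0%N t - (\poly_(n < N.+1) (g n 0 / n`!%:R)).[t]| <= K.
Proof.
elim: N g => [|N IH] g gd gK t t1.
  by rewrite poly_def big_ord1 expr0 alg_polyC hornerC divr1; exact: gK.
set P := \poly_(n < N.+2) _.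
have K0 : 0 <= K by apply: le_trans (gK 0 _); rewrite ?normr0 ?ler01.
have PE : P^`() = \poly_(n < N.+1) (g n.+1 0 / n`!%:R).
  apply/polyP => n; rewrite coef_deriv !coef_poly ltnS.
  case: ifP => // _; last by rewrite mul0rn.
  rewrite -mulr_natr factS natrM; field.
  by rewrite -[1]/(1%:R) -natrD !pnatr_eq0 -!lt0n fact_gt0.
pose r (s : R) : R := g 0%N s - P.[s].
have rd (s : R) : is_derive s (1 : R) r (g 1%N s - P^`().[s]).
  exact: (@is_deriveB _ _ R^o (g 0%N) (horner P) s 1 _ _ (gd 0%N isT s) (is_derive_poly P s)).
have [c ct] := MVT_from0 t rd.
have -> : r 0 = 0 by rewrite /r horner_coef0 coef_poly /= divr1 subrr.
rewrite subr0 /r => ->; rewrite PE normrM.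
have c1 := le_trans ct t1.
have := IH (fun n => g n.+1) (fun n nN => gd n.+1 nN) gK c c1.
by move=> gK'; rewrite -[leRHS]mul1r ler_pM.
Qed.

Lemma Dn_taylor f N x y (K : R) : Ck f N ->
  (forall c : R, `|c| <= 1 ->
     `|Dn f (nseq N y) (x + c *: y) - Dn f (nseq N y) x| <= K) ->
  `|f (x + y) - \sum_(n < N.+1) Dn f (nseq n y) x / n`!%:R| <= K.
Proof.
move=> fN fK; pose g n (t : R) : R := Dn f (nseq n y) (x + t *: y).
have gd n : (n < N)%N -> forall t : R, is_derive t (1 : R) (g n) (g n.+1 t).
  move=> nN t; apply: is_derive_line.
  by apply: Ck_derivable fN _; rewrite size_nseq.
have g0 n : g n 0 = Dn f (nseq n y) x by rewrite /g scale0r addr0.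
have gK t : `|t| <= 1 -> `|g N t - g N 0| <= K by move=> t1; rewrite g0; exact: fK.
have := taylor_bound gd gK (t := 1); rewrite normr1 lexx => /(_ isT).
rewrite {1}/g scale1r horner_poly; congr (`|_ - _| <= _).
by apply: eq_bigr => n _; rewrite expr1n mulr1 g0.
Qed.

End IteratedDerivatives.

(** * Coordinate functions, bounds on the tree vector fields, Hölder estimates *)

Section Coordinates.
Variables (R : realType) (d : nat).
Local Notation E := 'rV[R]_d.

Lemma norm_rV_le (v : E) (c : R) : 0 <= c -> (forall i, `|v ord0 i| <= c) -> `|v| <= c.
Proof.
move=> c0 vc; rewrite [leLHS]/Num.Def.normr /= mx_normrE bigmax_le // => -[i j] _ /=.
by rewrite ord1; exact: vc.
Qed.

Lemma Dn_coord (F : E -> E) k i vs : Ck F k -> (size vs <= k)%N ->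
  Dn (fun x => F x ord0 i : R^o) vs = fun x => Dn F vs x ord0 i.
Proof.
move=> Fk; elim: vs => [//|v vs IH] vsk; rewrite !Dn_cons IH ?(ltnW vsk) //.
by apply/funext => x; rewrite derive_mx ?mxE //; exact: Ck_derivable Fk vsk.
Qed.

Lemma Ck_coord (F : E -> E) k i : Ck F k -> Ck (fun x => F x ord0 i : R^o) k.
Proof.
move=> Fk vs vsk; rewrite (Dn_coord _ Fk vsk); split=> [x|vsk' x v].
  have cF : continuous (Dn F vs) by exact: Ck_continuous Fk vsk.
  have cc : continuous (fun y : E => y ord0 i) by exact: coord_continuous.
  exact: (continuous_comp (cF x) (cc _)).
have /derivable_mxP : derivable (Dn F vs) x v by exact: Ck_derivable Fk vsk'.
exact.
Qed.

Lemma Ck_le (W : normedModType R) (f : E -> W) m n : (m <= n)%N -> Ck f n -> Ck f m.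
Proof.
move=> mn fn vs vsm; have [cf df] := fn vs (leq_trans vsm mn).
by split=> // vsm'; apply: df; exact: leq_trans mn.
Qed.

Lemma Dn_id (vs : seq E) : Dn (@id E) vs =
  match vs with [::] => id | [:: v] => fun=> v | _ => fun=> 0 end.
Proof.
elim: vs => [//|v [_|w vs IH]]; first by apply/funext => x; rewrite Dn_cons derive_id.
rewrite Dn_cons {}IH; apply/funext => x.
by case: vs => [|u vs]; exact: derive_cst.
Qed.

Lemma Ck_id k : Ck (@id E) k.
Proof.
move=> vs _; rewrite Dn_id; case: vs => [|v [|w vs]]; split=> // *;
  by [exact: derivable_id | exact: derivable_cst | exact: cst_continuous | move=> ?; exact: cvg_id].
Qed.

(** As [k] is at least 2, derivatives of order [k] of a coordinate vanish, hence the Hölder constant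
    0. *)
Lemma Cgamma_coord gamma k i : k%:R < gamma <= k.+1%:R -> (1 < k)%N ->
  Cgamma gamma (fun x : E => x ord0 i : R^o).
Proof.
move=> k_gamma k1; exists k; split=> //; split; first exact/Ck_coord/Ck_id.
move=> M; exists 0 => vs x y vsk _ _ _.
rewrite !(Dn_coord i (@Ck_id k)) ?vsk // Dn_id; move: vsk k1.
by case: vs => [|v [|w vs]] /= => [<-|<-|_ _] //; rewrite subrr normr0 mul0r.
Qed.

Lemma Vf_coord l (V : 'I_l -> E -> E) phi x i :
  Vf V (fun y : E => y ord0 i : R^o) phi x = Vf V (@id E) phi x ord0 i.
Proof. by rewrite /Vf (Dn_coord _ (@Ck_id (size phi))) ?size_map // mxE. Qed.

Lemma bailleul_davie l (V : 'I_l -> E -> E) p T gamma X z k :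
  k%:R < gamma <= k.+1%:R -> (1 < k)%N ->
  bailleul_sol V p T gamma X z -> davie_sol V p T X z.
Proof.
move=> k_gamma k1 [a [a1 za]]; exists a; split=> //.
(* The exponent [a] precedes the test function in Bailleul's definition, so the coordinates share it
   and only the constants vary. *)
have /choice[C zC] := fun i => za _ (Cgamma_coord i k_gamma k1).
exists (\sum_i `|C i|) => s t s0 st tT.
apply: norm_rV_le => [|i].
  by rewrite mulr_ge0 ?powR_ge0 // sumr_ge0.
have := zC i s t s0 st tT; rewrite !mxE summxE.
under eq_bigr do rewrite Vf_coord.
under [X in _ -> `|_ - X| <= _]eq_bigr do rewrite mxE.
move=> /le_trans; apply; rewrite ler_wpM2r ?powR_ge0 // (le_trans (ler_norm _)) //.
by rewrite (bigD1 i) //= lerDl sumr_ge0.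
Qed.

Lemma Vlab_ord l (V : 'I_l -> E -> E) a (al : (a < l)%N) : Vlab V a = V (Ordinal al).
Proof. by rewrite /Vlab insubT. Qed.

(** Each node uses as many derivatives as it has children, fewer than [tsize u], so [k] derivatives
    suffice at all nodes. [Dn_bounded] is scalar and is applied to each coordinate. *)
Lemma Vt_bounded l (V : 'I_l -> E -> E) k (M : R) u :
  (forall i, Ck (V i) k) -> wft l u -> (tsize u <= k)%N ->
  exists2 K : R, 0 <= K & forall x, `|x| <= M -> `|Vt V u x| <= K.
Proof.
move=> Vk; elim/rtree_nested_ind: u => a ch IH /= /andP[al ch_wft] chk.
have [P P0 chP] : exists2 P : R, 0 <= P & forall x, `|x| <= M ->
    \prod_(v <- [seq Vt V c x | c <- ch]) `|v| <= P.
  elim: ch IH ch_wft chk => [|c ch IHch] IH /= => [_ _|/andP[c_wft ch_wft] chk].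
    by exists 1 => // x _; rewrite big_nil.
  have [||P P0 chP] := IHch _ ch_wft; [|by lia|].
    by move=> e ech; apply: IH; rewrite inE ech orbT.
  have [|K K0 cK] := IH c (mem_head _ _) c_wft; first by lia.
  exists (K * P) => [|x xM]; first exact: mulr_ge0.
  by rewrite big_cons ler_pM ?cK ?chP // prodr_ge0.
have chk' : (size ch <= k)%N.
  by rewrite (leq_trans (size_le_fsize ch)) // ltnW.
have /choice[B B_spec] : forall i : 'I_d, exists B : R, 0 <= B /\
    forall (vs : seq E) x, size vs = size ch -> `|x| <= M ->
    `|Dn (fun y => V (Ordinal al) y ord0 i : R^o) vs x| <= B * \prod_(v <- vs) `|v|.
  move=> i; have [|B B0 VB] := @Dn_bounded R d _ k (size ch) [::] M (Ck_coord i (Vk (Ordinal al))).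
    by rewrite addn0.
  by exists B; split=> // vs x vsn xM; have := VB vs x vsn xM; rewrite cats0.
set sg := (X in X%:R^-1); exists (sg%:R^-1 * (\sum_i B i * P)) => [|x xM].
  by rewrite mulr_ge0 ?invr_ge0 // sumr_ge0 // => i _; rewrite mulr_ge0 // (B_spec i).1.
rewrite (Vlab_ord V al) normrZ ger0_norm ?invr_ge0 // ler_wpM2l ?invr_ge0 //.
apply: norm_rV_le => [|i].
  by rewrite sumr_ge0 // => i _; rewrite mulr_ge0 // (B_spec i).1.
have Dsize : size [seq Vt V c x | c <- ch] = size ch by rewrite size_map.
have := (B_spec i).2 _ x Dsize xM; rewrite (Dn_coord _ (Vk _)) ?Dsize //.
move/le_trans; apply; rewrite (bigD1 i) //= (@le_trans _ _ (B i * P)) //.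
  by rewrite ler_wpM2l ?(B_spec i).1 ?chP.
by rewrite lerDl sumr_ge0 // => j _; rewrite mulr_ge0 // (B_spec j).1.
Qed.

(** If [N] is below the integer [k] of [Cgamma], the exponent is 1 and the estimate is the Lipschitz
    bound; if [N = k], it is gamma - N. In the latter case [Cgamma] speaks of directions of norm at
    most 1, so [v] is normalised and its norm pulled out of the [N] slots. *)
Lemma Dn_holder f gamma N (M : R) : @Cgamma R d R^o gamma f -> N%:R < gamma ->
  exists2 H : R, 0 <= H & forall x y v : E, `|x| <= M -> `|y| <= M ->
  `|Dn f (nseq N v) x - Dn f (nseq N v) y| <=
    H * `|v| ^+ N * `|x - y| `^ (Num.min gamma N.+1%:R - N%:R).
Proof.
move=> [k [/andP[k_gamma gamma_k] [fk fH]]] N_gamma.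
have kN : (N <= k)%N by rewrite -ltnS -(ltr_nat R) (lt_le_trans N_gamma).
case: ltngtP kN => // [Nk _|Nk _].
  have [B B0 fB] := Dn_lipschitz M fk Nk; exists B => // x y v xM yM.
  have := fB (nseq N v) x y (size_nseq _ _) xM yM; rewrite big_nseq iter_mulr_1.
  rewrite min_r; last by rewrite (le_trans _ (ltW k_gamma)) // ler_nat.
  by rewrite -natrB // subSnn powRr1.
rewrite -{}Nk in k_gamma gamma_k fk fH.
have [C fC] := fH M; exists `|C| => // x y v xM yM.
have vE u : Dn f (nseq N v) u = `|v| ^+ N * Dn f (nseq N (`|v|^-1 *: v)) u.
  have {1}-> : v = `|v| *: (`|v|^-1 *: v).
    have [->|v0] := eqVneq v 0; first by rewrite !scaler0.
    by rewrite scalerA divff ?normr_eq0 // scale1r.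
  have := @Dn_scale R d f N _ (iota 0 N) (fun=> `|v|) (fun=> `|v|^-1 *: v) [::] u fk.
  rewrite size_iota addn0 => /(_ (leqnn N)); rewrite !cats0 big_const_seq count_predT size_iota.
  rewrite iter_mulr_1 => DE.
  have mapE (w : E) : [seq w | _ <- iota 0 N] = nseq N w.
    by rewrite -[X in nseq X](size_iota 0 N); elim: (iota 0 N) => //= _ s ->.
  by rewrite -!mapE.
rewrite !vE -mulrBr normrM ger0_norm ?exprn_ge0 // mulrAC [leRHS]mulrC.
rewrite min_l // ler_wpM2l ?exprn_ge0 //.
apply: le_trans (fC _ _ _ (size_nseq _ _) _ xM yM) _.
  apply/allP => w; rewrite mem_nseq => /andP[_ /eqP->].
  rewrite normrZ normfV normr_id; have [->|v0] := eqVneq v 0; first by rewrite normr0 mulr0.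
  by rewrite mulVf ?normr_eq0.
by rewrite ler_wpM2r ?powR_ge0 // ler_norm.
Qed.

End Coordinates.
(** * Power bounds on increments *)

Section PowerBounds.
Variables (R : realType) (T : R).
Implicit Types (F G : R -> R -> R) (b c : R).

(** A power with exponent 0 equals 1 even at base 0, so [bigOpow 0] means bounded, diagonal
    included. *)
Definition bigOpow b F := exists2 C : R, 0 <= C & forall s t,
  0 <= s -> s <= t -> t <= T -> `|F s t| <= C * (t - s) `^ b.

Lemma bigOpow_le b F G : bigOpow b G ->
  (forall s t, 0 <= s -> s <= t -> t <= T -> `|F s t| <= `|G s t|) -> bigOpow b F.
Proof.
move=> [C C0 GC] FG; exists C => // s t s0 st tT.
by rewrite (le_trans (FG _ _ _ _ _)) // GC.
Qed.

Lemma bigOpow_le_bound b F (C : R) :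
  (forall s t, 0 <= s -> s <= t -> t <= T -> `|F s t| <= C * (t - s) `^ b) -> bigOpow b F.
Proof.
move=> FC; exists `|C| => // s t s0 st tT; rewrite (le_trans (FC _ _ _ _ _)) //.
by rewrite ler_wpM2r ?powR_ge0 // ler_norm.
Qed.

Lemma bigOpow0 b : bigOpow b (fun _ _ => 0).
Proof. by exists 0 => // s t _ _ _; rewrite normr0 mul0r. Qed.

Lemma bigOpowD b F G : bigOpow b F -> bigOpow b G -> bigOpow b (fun s t => F s t + G s t).
Proof.
move=> [C C0 FC] [D D0 GD]; exists (C + D) => [|s t s0 st tT]; first exact: addr_ge0.
by rewrite mulrDl (le_trans (ler_normD _ _)) // lerD ?FC ?GD.
Qed.

Lemma bigOpow_sum b (I : eqType) (r : seq I) (P : pred I) (F : I -> R -> R -> R) :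
  (forall i, i \in r -> P i -> bigOpow b (F i)) ->
  bigOpow b (fun s t => \sum_(i <- r | P i) F i s t).
Proof.
elim: r => [|i r IH] FP.
  by apply: bigOpow_le (bigOpow0 b) _ => s t _ _ _; rewrite big_nil.
have Fr : bigOpow b (fun s t => \sum_(i <- r | P i) F i s t).
  by apply: IH => j jr; apply: FP; rewrite inE jr orbT.
case Pi: (P i).
  apply: bigOpow_le (bigOpowD (FP i (mem_head _ _) Pi) Fr) _ => s t _ _ _.
  by rewrite big_cons Pi.
by apply: bigOpow_le Fr _ => s t _ _ _; rewrite big_cons Pi.
Qed.

Lemma bigOpowM b c F G : 0 <= b -> 0 <= c -> bigOpow b F -> bigOpow c G ->
  bigOpow (b + c) (fun s t => F s t * G s t).
Proof.
move=> b0 c0 [C C0 FC] [D D0 GD]; exists (C * D) => [|s t s0 st tT]; first exact: mulr_ge0.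
have -> : (t - s) `^ (b + c) = (t - s) `^ b * (t - s) `^ c.
  have [bc0|bc0] := eqVneq (b + c) 0; last by rewrite powRD // (negPf bc0).
  move/eqP: bc0; rewrite paddr_eq0 // => /andP[/eqP-> /eqP->].
  by rewrite addr0 !powRr0 mulr1.
by rewrite normrM mulrACA ler_pM // ?FC ?GD.
Qed.

(** The surplus power of t - s is at most that of [T]. The diagonal is treated apart because
    exponents do not add freely at base 0. *)
Lemma bigOpow_weaken b c F : 0 <= b -> b <= c -> bigOpow c F -> bigOpow b F.
Proof.
move=> b0 bc [C C0 FC]; exists (C * T `^ (c - b)) => [|s t s0 st tT].
  by rewrite mulr_ge0 ?powR_ge0.
rewrite (le_trans (FC _ _ _ _ _)) // -mulrA ler_wpM2l //.
have ts0 : 0 <= t - s by rewrite subr_ge0.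
have [ts|ts] := eqVneq (t - s) 0.
  rewrite ts; have [c0|c0] := eqVneq c 0.
    have b00 : b = 0 by apply/eqP; rewrite eq_le b0 andbT -c0.
    by rewrite c0 b00 subrr !powRr0 mulr1.
  by rewrite powR0 // mulr_ge0 ?powR_ge0.
have -> : (t - s) `^ c = (t - s) `^ (c - b) * (t - s) `^ b.
  by rewrite -powRD ?subrK // ts implybT.
rewrite ler_wpM2r ?powR_ge0 //.
by apply: ge0_ler_powR; rewrite ?nnegrE ?subr_ge0 //; lra.
Qed.

Lemma bigOpow_powR b c F : 0 <= c -> bigOpow b F ->
  bigOpow (b * c) (fun s t => `|F s t| `^ c).
Proof.
move=> c0 [C C0 FC]; exists (C `^ c) => [|s t s0 st tT]; first exact: powR_ge0.
rewrite ger0_norm ?powR_ge0 // powRrM -powRM ?powR_ge0 //.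
by apply: ge0_ler_powR; rewrite ?nnegrE ?mulr_ge0 ?powR_ge0 ?FC.
Qed.

Lemma bigOpow_bounded b F : 0 <= b -> bigOpow b F ->
  exists2 C : R, 0 <= C & forall s t, 0 <= s -> s <= t -> t <= T -> `|F s t| <= C.
Proof.
move=> b0 /(bigOpow_weaken (lexx 0) b0) [C C0 FC]; exists C => // s t s0 st tT.
by have := FC s t s0 st tT; rewrite powRr0 mulr1.
Qed.

Lemma bigOpow_cst (c : R) : bigOpow 0 (fun _ _ => c).
Proof. by exists `|c| => // s t _ _ _; rewrite powRr0 mulr1. Qed.

Lemma bigOpow_norm b F : bigOpow b F -> bigOpow b (fun s t => `|F s t|).
Proof. by move=> FO; apply: bigOpow_le FO _ => s t _ _ _; rewrite normr_id. Qed.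

Lemma bigOpow_prod (I : eqType) (r : seq I) (e : I -> R) (F : I -> R -> R -> R) :
  (forall i, i \in r -> 0 <= e i) -> (forall i, i \in r -> bigOpow (e i) (F i)) ->
  bigOpow (\sum_(i <- r) e i) (fun s t => \prod_(i <- r) F i s t).
Proof.
elim: r => [|i r IH] e0 FO.
  by rewrite big_nil; apply: bigOpow_le (bigOpow_cst 1) _ => s t _ _ _; rewrite big_nil.
rewrite big_cons.
have e0r j : j \in r -> 0 <= e j by move=> jr; apply: e0; rewrite inE jr orbT.
have FOr : bigOpow (\sum_(j <- r) e j) (fun s t => \prod_(j <- r) F j s t).
  by apply: IH e0r _ => j jr; apply: FO; rewrite inE jr orbT.
have er0 : 0 <= \sum_(j <- r) e j by rewrite big_seq sumr_ge0.
apply: bigOpow_le (bigOpowM (e0 i (mem_head _ _)) er0 (FO i (mem_head _ _)) FOr) _.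
by move=> s t _ _ _; rewrite big_cons.
Qed.

End PowerBounds.

(** * The Taylor polynomial as a sum over forests *)

Section Expansion.
Variables (R : realType) (d l : nat) (V : 'I_l -> 'rV[R]_d -> 'rV[R]_d).
Local Notation E := 'rV[R]_d.

(* [Vt u] already carries the factor [1 / sigma u] and [Vf] divides by [sigma u] once
   more, so the vectors entering the expansion of a solution are these. *)
Definition Wt (x : E) (u : rtree) : E := (sigma u)%:R^-1 *: Vt V u x.

Lemma Vf_mult_fact (f : E -> R^o) k phi x : Ck f k -> (size phi <= k)%N ->
  Vf V f phi x = (mult_fact phi)%:R^-1 * Dn f (map (Wt x) phi) x.
Proof.
move=> fk phik; rewrite /Vf /sigmaf natrM invfM -[LHS]mulrA; congr (_ * _).
have := @Dn_scale R d f k _ phi (fun u => (sigma u)%:R^-1) (fun u => Vt V u x) [::] x fk.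
rewrite addn0 !cats0 => /(_ phik) ->; congr (_ * _).
by rewrite foldrE big_map natr_prod prodfV.
Qed.

Lemma sum_Vf_id (c : seq rtree -> R) N x :
  \sum_(phi <- basis_upto l N) c phi *: Vf V (@id E) phi x =
  \sum_(u <- trees_upto l N) c [:: u] *: Wt x u.
Proof.
rewrite (bigID (fun phi => size phi == 1%N)) /= big_trees_upto [X in _ + X]big1_seq ?addr0.
  apply: eq_bigr => u _; rewrite /Vf Dn_id /= /Wt /sigmaf /mult_fact /=.
  by rewrite eqxx !muln1 mul1n.
move=> phi /andP[phi1]; rewrite mem_basis_upto /Vf Dn_id.
by case: phi phi1 => [|u [|v phi]] //= _ _; rewrite !scaler0.
Qed.

(** The forest must be nonempty: [multiplicative_upto] alone does not exclude the value 0 on the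
    empty forest. *)
Lemma multiplicative_prod N (Y : dual R) f : multiplicative_upto N Y ->
  (0 < size f)%N -> (fsize f <= N)%N -> \prod_(u <- f) pair Y [:: u] = pair Y f.
Proof.
move=> mY; elim: f => // u [|v f] IH _ fN; first by rewrite big_seq1.
rewrite big_cons IH //; last by rewrite (leq_trans _ fN) // [in leqRHS]fsize_cons leq_addl.
by rewrite -mY //= /fsize /= addn0.
Qed.

Lemma sum_Dn_expansion (f : E -> R^o) k N (Y : dual R) x :
  Ck f k -> (N <= k)%N -> multiplicative_upto N Y ->
  \sum_(n < N.+1)
    Dn f (nseq n (\sum_(u <- trees_upto l N) pair Y [:: u] *: Wt x u)) x / n`!%:R =
  f x + \sum_(phi <- basis_upto l N) pair Y phi * Vf V f phi x +
  \sum_(n < N) \sum_(t <- words (trees_upto l N) n.+1 | ~~ (fsize t <= N)%N)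
     (\prod_(u <- t) pair Y [:: u]) * Dn f (map (Wt x) t) x / (n.+1)`!%:R.
Proof.
move=> fk Nk mY; rewrite big_ord_recl /= divr1 -addrA; congr (_ + _).
pose G t := (\prod_(u <- t) pair Y [:: u]) * Dn f (map (Wt x) t) x.
have Gperm n : (n < N)%N ->
    {in words (trees_upto l N) n.+1 &, forall t t', perm_eq t t' -> G t = G t'}.
  move=> nN t t'; rewrite !mem_words => /andP[/eqP tn _] _ tt'.
  rewrite /G (perm_big _ tt') (Dn_perm fk _ (perm_map (Wt x) tt')) // size_map tn.
  exact: leq_trans Nk.
(* Basis forests are sorted by their number of trees, which lies between 1 and [N]; the shift by one
   appears because the order 0 term was split off. *)
have -> : \sum_(phi <- basis_upto l N) pair Y phi * Vf V f phi x =
    \sum_(n < N) \sum_(phi <- basis_upto l N | size phi == n.+1)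
      (mult_fact phi)%:R^-1 * G phi.
  rewrite (exchange_big_dep predT) //=; apply: eq_big_seq => phi phiN.
  move: (phiN); rewrite mem_basis_upto => /and4P[_ _ phi0 phi_le].
  have phi_size : (0 < size phi)%N by case: (phi) phi0.
  have phiN' : (size phi <= N)%N := leq_trans (size_le_fsize phi) phi_le.
  have i_lt : ((size phi).-1 < N)%N by rewrite prednK.
  rewrite (big_pred1 (Ordinal i_lt)) => [|i]; last first.
    by rewrite /= -val_eqE /= -[RHS]eqSS prednK // eq_sym.
  rewrite (Vf_mult_fact _ fk) ?(leq_trans phiN') // /G (multiplicative_prod mY) //.
  by rewrite mulrCA.
rewrite -big_split; apply: eq_bigr => n _ /=.
have nN : (n.+1 <= N)%N by [].
have := @Dn_words R d f k _ (trees_upto l N) (fun u => pair Y [:: u]) (Wt x) n.+1 [::] x fk.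
rewrite addn0 !cats0 /bump /= add1n => /(_ (leq_trans nN Nk)) ->.
under eq_bigr do rewrite cats0.
rewrite (bigID (fun t => (fsize t <= N)%N)) mulrDl /=; congr (_ + _); last by rewrite mulr_suml.
rewrite -[X in X / _]/(\sum_(t <- words _ n.+1 | (fsize t <= N)%N) G t).
rewrite sum_words_forests //; last exact: Gperm.
rewrite mulr_suml; apply: eq_bigr => phi _.
have fact0 : (n.+1)`!%:R != 0 :> R by rewrite pnatr_eq0 -lt0n fact_gt0.
by rewrite [LHS]mulrC !mulrA mulVf // mul1r.
Qed.

End Expansion.

(** * Davie's expansion implies Bailleul's *)

Lemma powR_splitn (R : realType) (y g : R) n : (0 < n)%N -> 0 <= y -> n%:R <= g ->
  y `^ g = y ^+ n * y `^ (g - n%:R).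
Proof.
move=> n0 y0 ng; have nE : n%:R + (g - n%:R) = g by rewrite addrC subrK.
by rewrite -powR_mulrn // -powRD nE // gt_eqF // (lt_le_trans _ ng) // ltr0n.
Qed.

Lemma Cgamma_Ck (R : realType) d (W : normedModType R) gamma (f : 'rV[R]_d -> W) N :
  Cgamma gamma f -> N%:R < gamma -> Ck f N.
Proof.
move=> [k [/andP[_ gamma_k] [fk _]]] N_gamma; apply: Ck_le fk.
by rewrite -ltnS -(ltr_nat R) (lt_le_trans N_gamma).
Qed.

Section DavieToBailleul.
Variables (R : realType) (l d : nat) (p T gamma : R) (X : R -> dual R).
Variables (V : 'I_l -> 'rV[R]_d -> 'rV[R]_d) (z : R -> 'rV[R]_d) (a C : R).
Hypotheses (p1 : 1 <= p) (XP : branched_rough_path l p T X) (p_gamma : p < gamma).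
Hypothesis V_gamma : forall i : 'I_l, Cgamma gamma (V i).
Hypothesis a1 : 1 < a.
Let N := ip p.
Let S := trees_upto l N.
Let Y s t := \sum_(u <- S) pair (incr p X s t) [:: u] *: Wt V (z s) u.
Hypothesis zC : forall s t, 0 <= s -> s <= t -> t <= T ->
  `|z t - z s - Y s t| <= C * (t - s) `^ a.

Let p_gt0 : 0 < p. Proof. exact: lt_le_trans p1. Qed.

Let N_bounds : N%:R <= p < N.+1%:R.
Proof. by apply: truncn_itv; exact: ltW. Qed.

Let N_gamma : N%:R < gamma.
Proof. by case/andP: N_bounds => Np _; exact: le_lt_trans Np p_gamma. Qed.

Let N_gt0 : (0 < N)%N.
Proof. by case/andP: N_bounds => _ pN; rewrite -ltnS -(ltr_nat R) (le_lt_trans p1). Qed.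

Lemma incr_tree_bigO u : u \in S ->
  bigOpow T ((tsize u)%:R / p) (fun s t => pair (incr p X s t) [:: u]).
Proof.
move=> uS; have [uu u_wft uN] := trees_uptoP uS.
have fsu : fsize [:: u] = tsize u by rewrite /fsize /= addn0.
have [D XD] : exists D : R, forall s t, 0 <= s -> s < t -> t <= T ->
    `|pair (incr p X s t) [:: u]| <= D * (t - s) `^ ((tsize u)%:R / p).
  by have [_ /(_ [:: u])] := XP; rewrite /= u_wft fsu => /(_ isT uN).
exists `|D| => // s t s0; rewrite le_eqVlt => /predU1P[<-|st] tT.
  by rewrite (incr_refl XP) ?s0 // normr0 mulr_ge0 ?powR_ge0.
by rewrite (le_trans (XD _ _ _ _ _)) // ler_wpM2r ?powR_ge0 // ler_norm.
Qed.

Lemma davie_error_bigO : bigOpow T a (fun s t => `|z t - z s - Y s t|).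
Proof. by apply: (@bigOpow_le_bound _ _ _ _ C) => s t *; rewrite normr_id zC. Qed.

Lemma norm_tree_sum_le s t x :
  `|\sum_(u <- S) pair (incr p X s t) [:: u] *: Wt V x u| <=
  \sum_(u <- S) `|pair (incr p X s t) [:: u]| * `|Wt V x u|.
Proof.
rewrite (le_trans (ler_norm_sum _ _ _)) //.
by apply: ler_sum => u _; rewrite normrZ.
Qed.

Let tsize_p_ge0 u : 0 <= (tsize u)%:R / p.
Proof. by rewrite divr_ge0 // ltW. Qed.

(** With initial time 0 the vector fields are evaluated at the fixed point [z 0], so no bound on the
    path is presupposed. *)
Lemma davie_bounded : exists2 M : R, 0 <= M & forall s, 0 <= s -> s <= T -> `|z s| <= M.
Proof.
have [B0 B00 FB0] : exists2 B : R, 0 <= B & forall s t, 0 <= s -> s <= t -> t <= T ->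
    `|\sum_(u <- S) `|pair (incr p X s t) [:: u]| * `|Wt V (z 0) u| | <= B.
  apply: (@bigOpow_bounded _ _ 0) => //; apply: bigOpow_sum => u uS _.
  rewrite -[0](addr0 0); apply: bigOpowM => //; last exact: bigOpow_cst.
  by apply: bigOpow_weaken (bigOpow_norm (incr_tree_bigO uS)).
have [B1 B10 FB1] := bigOpow_bounded (ltW (lt_trans ltr01 a1)) davie_error_bigO.
exists (B1 + (B0 + `|z 0|)) => [|s s0 sT]; first by rewrite !addr_ge0.
have -> : z s = (z s - z 0 - Y 0 s) + (Y 0 s + z 0).
  by rewrite addrA subrK subrK.
rewrite (le_trans (ler_normD _ _)) // lerD //.
  by rewrite -[leLHS]normr_id FB1.
rewrite (le_trans (ler_normD _ _)) // lerD // (le_trans (norm_tree_sum_le _ _ _)) //.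
by rewrite (le_trans (ler_norm _)) // FB0.
Qed.

Lemma Wt_bigO u : u \in S -> bigOpow T 0 (fun s t => `|Wt V (z s) u|).
Proof.
move=> uS; have [uu u_wft uN] := trees_uptoP uS.
have [M M0 zM] := davie_bounded.
have [K K0 VK] := Vt_bounded M (fun i => Cgamma_Ck (V_gamma i) N_gamma) u_wft uN.
exists ((sigma u)%:R^-1 * K) => [|s t s0 st tT]; first by rewrite mulr_ge0 ?invr_ge0.
rewrite powRr0 mulr1 normr_id normrZ ger0_norm ?invr_ge0 // ler_wpM2l ?invr_ge0 //.
by rewrite VK // zM // (le_trans st).
Qed.

(** The trees with one vertex dominate. *)
Lemma tree_sum_bigO : bigOpow T p^-1 (fun s t => `|Y s t|).
Proof.
have SO : bigOpow T p^-1
    (fun s t => \sum_(u <- S) `|pair (incr p X s t) [:: u]| * `|Wt V (z s) u|).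
  apply: bigOpow_sum => u uS _; apply: (@bigOpow_weaken _ _ _ ((tsize u)%:R / p + 0)).
  - by rewrite invr_ge0 ltW.
  - by rewrite addr0; apply: ler_peMl; [rewrite invr_ge0 ltW|rewrite ler1n tsize_gt0].
  by apply: bigOpowM => //; [exact: bigOpow_norm (incr_tree_bigO uS)|exact: Wt_bigO].
apply: bigOpow_le SO _ => s t _ _ _; rewrite normr_id.
by rewrite (le_trans (norm_tree_sum_le _ _ _)) // ler_norm.
Qed.

Lemma prod_incr_bigO w : all (mem S) w ->
  bigOpow T ((fsize w)%:R / p) (fun s t => \prod_(u <- w) pair (incr p X s t) [:: u]).
Proof.
move=> /allP wS.
have -> : (fsize w)%:R / p = \sum_(u <- w) (tsize u)%:R / p.
  by rewrite /fsize sumnE big_map natr_sum mulr_suml.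
by apply: bigOpow_prod => // u /wS /incr_tree_bigO.
Qed.

Lemma Dn_Wt_bigO (f : 'rV[R]_d -> R^o) w : Ck f N -> all (mem S) w -> (size w <= N)%N ->
  bigOpow T 0 (fun s t => Dn f (map (Wt V (z s)) w) (z s)).
Proof.
move=> fN /allP wS wN; have [M M0 zM] := davie_bounded.
have [|B B0 fB] := @Dn_bounded R d f N (size w) [::] M fN; first by rewrite addn0.
have WO : bigOpow T 0 (fun s t => \prod_(u <- w) `|Wt V (z s) u|).
  have := @bigOpow_prod R T _ w (fun=> 0) (fun u s t => `|Wt V (z s) u|).
  by rewrite big1 //; apply=> // u /wS /Wt_bigO.
have := bigOpowM (lexx 0) (lexx 0) (bigOpow_cst T B) WO; rewrite addr0.
move/bigOpow_le; apply=> s t s0 st tT.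
have := fB (map (Wt V (z s)) w) (z s); rewrite size_map cats0 big_map => fBw.
by rewrite (le_trans (fBw _ _)) ?ler_norm // zM // (le_trans st).
Qed.

(** [a] is Davie's error, gamma / p or (N+1) / p comes from the Taylor remainder, and (N+1) / p from
    words with more than [N] vertices. *)
Let b := Num.min a (Num.min gamma N.+1%:R / p).

Lemma exponent_gt1 : 1 < b.
Proof.
case/andP: N_bounds => _ pN.
by rewrite lt_min a1 ltr_pdivlMr // mul1r lt_min p_gamma pN.
Qed.

Let b_ge0 : 0 <= b. Proof. exact: ltW (lt_trans ltr01 exponent_gt1). Qed.

Lemma davie_bailleul_bound (f : 'rV[R]_d -> R^o) : Cgamma gamma f ->
  bigOpow T b (fun s t => f (z t) - f (z s) -
    \sum_(phi <- basis_upto l N) pair (incr p X s t) phi * Vf V f phi (z s)).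
Proof.
move=> f_gamma; have fN := Cgamma_Ck f_gamma N_gamma.
have [M M0 zM] := davie_bounded.
have pV_ge0 : 0 <= p^-1 by rewrite invr_ge0 ltW.
have {pV_ge0} [MY MY0 YM] := bigOpow_bounded pV_ge0 tree_sum_bigO.
have normY s t : 0 <= s -> s <= t -> t <= T -> `|Y s t| <= MY.
  by move=> s0 st tT; rewrite -normr_id YM.
pose g := Num.min gamma N.+1%:R.
(* [E1] is the cost of replacing [z t] by its Davie approximation, [E2] the Taylor remainder and
   [E3] the words too long to belong to the basis; their sum is the error in Bailleul's
   expansion. *)
pose E1 s t := f (z t) - f (z s + Y s t).
pose E2 s t := f (z s + Y s t) - \sum_(n < N.+1) Dn f (nseq n (Y s t)) (z s) / n`!%:R.
pose E3 s t := \sum_(n < N) \sum_(w <- words S n.+1 | ~~ (fsize w <= N)%N)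
  (\prod_(u <- w) pair (incr p X s t) [:: u]) * Dn f (map (Wt V (z s)) w) (z s) / (n.+1)`!%:R.
have E1O : bigOpow T b E1.
  apply: (@bigOpow_weaken _ _ _ a) => //; first by rewrite ge_min lexx.
  have [B B0 fB] := Dn_lipschitz (M + MY) fN N_gt0.
  have := bigOpowM (lexx 0) (ltW (lt_trans ltr01 a1)) (bigOpow_cst T B) davie_error_bigO.
  rewrite add0r => /bigOpow_le; apply=> s t s0 st tT.
  have := fB [::] (z t) (z s + Y s t) erefl; rewrite big_nil mulr1 /E1 opprD addrA.
  move=> fB'; rewrite (le_trans (fB' _ _)) ?ler_norm //.
    by rewrite (le_trans (zM _ _ _)) ?lerDl // (le_trans s0).
  by rewrite (le_trans (ler_normD _ _)) // lerD ?normY // zM // (le_trans st).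
have E2O : bigOpow T b E2.
  have [H H0 fH] := Dn_holder (M + MY) f_gamma N_gamma.
  apply: (@bigOpow_weaken _ _ _ (0 + p^-1 * g)) => //.
    by rewrite add0r mulrC ge_min lexx orbT.
  have g0 : 0 <= g by rewrite le_min ler0n andbT ltW // (lt_trans p_gt0).
  have gN : 0 <= g - N%:R by rewrite subr_ge0 le_min ler_nat leqnSn ltW.
  apply: bigOpow_le (bigOpowM (lexx 0) _ (bigOpow_cst T H) (bigOpow_powR g0 tree_sum_bigO)) _.
    by rewrite mulr_ge0 // invr_ge0 ltW.
  move=> s t s0 st tT; rewrite normr_id [leRHS]ger0_norm ?mulr_ge0 ?powR_ge0 //.
  (* [N] powers come from the slots of the derivative, the rest from its Hölder continuity. *)
  have -> : `|Y s t| `^ g = `|Y s t| ^+ N * `|Y s t| `^ (g - N%:R).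
    by apply: powR_splitn => //; rewrite -subr_ge0.
  rewrite mulrA; apply: Dn_taylor => // c c1.
  have cY : `|c *: Y s t| <= `|Y s t| by rewrite normrZ ler_piMl.
  have zs : `|z s| <= M by rewrite zM // (le_trans st).
  apply: le_trans (fH _ _ _ _ _) _.
  - by rewrite (le_trans (ler_normD _ _)) // lerD // (le_trans cY) // normY.
  - by rewrite (le_trans zs) // lerDl.
  rewrite ler_wpM2l ?mulr_ge0 ?exprn_ge0 // [z s + _]addrC addrK.
  by apply: ge0_ler_powR; rewrite ?nnegrE.
have E3O : bigOpow T b E3.
  apply: bigOpow_sum => n _ _; apply: bigOpow_sum => w.
  rewrite mem_words -ltnNge => /andP[/eqP wn wS] Nw.
  apply: (@bigOpow_weaken _ _ _ ((fsize w)%:R / p + 0 + 0)) => //.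
    rewrite !addr0 /b ge_min; apply/orP; right; rewrite ler_pM2r ?invr_gt0 //.
    by rewrite ge_min; apply/orP; right; rewrite ler_nat.
  have fw0 : 0 <= (fsize w)%:R / p by rewrite divr_ge0 // ltW.
  apply: bigOpowM => //; [by rewrite addr0| |exact: bigOpow_cst].
  apply: bigOpowM => //; first exact: prod_incr_bigO.
  by apply: Dn_Wt_bigO => //; rewrite wn.
have EO := bigOpowD E1O (bigOpowD E2O E3O).
apply: bigOpow_le EO _ => s t s0 st tT.
have s_T : 0 <= s <= T by rewrite s0 (le_trans st).
have t_T : 0 <= t <= T by rewrite (le_trans s0 st).
have mX := incr_multiplicative XP s_T t_T.
rewrite /E1 /E2 /E3 (sum_Dn_expansion V (z s) fN (leqnn N) mX) -/N -/S.
have alg (A B D F G : R) : A - B - F = A - D + (D - (B + F + G) + G) by ring.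
by rewrite -alg.
Qed.

End DavieToBailleul.

Theorem theorem2 (R : realType) (l d : nat) (p T gamma : R)
  (X : R -> dual R) (V : 'I_l -> 'rV[R]_d -> 'rV[R]_d) (z : R -> 'rV[R]_d) :
  (1 <= l)%N -> (1 <= d)%N -> 2 < p -> 0 < T ->
  branched_rough_path l p T X ->
  p < gamma -> (forall i : 'I_l, Cgamma gamma (V i)) ->
  (davie_sol V p T X z <-> bailleul_sol V p T gamma X z).
Proof.
move=> l1 _ p2 _ XP p_gamma V_gamma; split.
  case=> a [a1 [C zC]].
  have p1 : 1 <= p by lra.
  have zC' s t : 0 <= s -> s <= t -> t <= T -> `|z t - z s -
      \sum_(u <- trees_upto l (ip p)) pair (incr p X s t) [:: u] *: Wt V (z s) u| <=
      C * (t - s) `^ a.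
    by move=> s0 st tT; have := zC s t s0 st tT; rewrite sum_Vf_id.
  exists (Num.min a (Num.min gamma (ip p).+1%:R / p)); split.
    exact: exponent_gt1.
  move=> f f_gamma; have [B B0 fB] := davie_bailleul_bound p1 XP p_gamma V_gamma a1 zC' f_gamma.
  by exists B.
(* Since [l] is positive there is a vector field from which to read the integer [k]; then k + 1 >=
   gamma > p > 2 gives k >= 2. *)
have [k [k_gamma _]] := V_gamma (Ordinal l1).
apply: (bailleul_davie k_gamma); case/andP: k_gamma => _ gamma_k.
by rewrite -ltnS -(ltr_nat R) (lt_le_trans _ gamma_k) // (lt_trans p2).
Qed.
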